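(* Let $U\subset\mathbb{R}^n$, $V\subset\mathbb{R}^m$ be open, let $X\subset U$, $Y\subset V$ be closed in $U$, $V$ respectively, and let $\varphi:V\to U$ be a $\mathcal{C}^p$ mapping with $\varphi(Y)\subset X$. Then: (1) For every $b\in Y$ and $\eta\in\tau^p_b(Y)$ one has $\varphi_{*b}(\eta)\in\tau^p_{\varphi(b)}(X)$, and the map $\varphi_*:\tau^p(Y)\to\tau^p(X)$, $(b,\eta)\mapsto(\varphi(b),\varphi_{*b}(\eta))$, is a bundle morphism (continuous, and linear on each fibre). Moreover, let $f:X\to\mathbb{R}$, set $g=f\circ\varphi:Y\to\mathbb{R}$, and suppose $\nabla^pf:\tau^p(X)\to\mathbb{R}$. Then: (2) $\nabla^pg:\tau^p(Y)\to\mathbb{R}$, and for $b\in Y$, $\eta\in\tau^p_b(Y)$: $\nabla^pg(\eta)=\nabla^pf(\varphi_{*b}\eta)$. (3) Let $b\in Y$, $a=\varphi(b)$, and choose $P\in\mathcal{P}_p(\mathbb{R}^n)$ such that $\xi(P)=\nabla^pf(\xi)$ for all $\xi\in\tau^p_a(X)$. Then $\nabla^pg(\eta)=\eta(\varphi^*_b(P))$ for all $\eta\in\tau^p_b(Y)$.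
   Context: For $d\in\{n,m\}$ and a closed subset $Z$ of an open set in $\mathbb{R}^d$: $\mathcal{P}_p=\mathcal{P}_p(\mathbb{R}^d)$ is the space of real polynomials of degree $\le p$, $\mathcal{P}_p^*$ its dual, $r=\dim\mathcal{P}_p$; for $\zeta\in\mathcal{P}_p^*$, $c\in\mathbb{R}^d$, $|\gamma|\le p$: $\zeta_\gamma(c):=\zeta(\tfrac1{\gamma!}(x-c)^\gamma)$; $\delta_a(P)=P(a)$. A bundle over $Z$ with fibres in $W$ is a subset of $Z\times W$ with linear-subspace fibres. For a bundle $E\subset Z\times\mathcal{P}_p^*$: $\Delta E=\{(a,b,\xi+\eta):a,b\in Z,\xi\in E_a,\eta\in E_b,|a-b|^{p-|\gamma|}|\eta_\gamma(b)|\le1\ \forall|\gamma|\le p\}$, $E'=\{(a,\xi):(a,a,\xi)\in\overline{\Delta E}\}$, $\rho(E)=\{(a,\xi):\xi\in\operatorname{Span}E'_a\}$; $\tau^p(Z):=\rho^{2r}(E_0)$ with $E_0=\{(a,\lambda\delta_a)\}$ (iterates constant from $2r$ on). For $h:Z\to\mathbb{R}$ and bundles $\Phi\subset Z\times(\mathcal{P}_p^*\times\mathbb{R})$: $\Delta\Phi=\{(a,b,\xi+\eta,\lambda+\mu):(\xi,\lambda)\in\Phi_a,(\eta,\mu)\in\Phi_b,|a-b|^{p-|\gamma|}|\eta_\gamma(b)|\le1\ \forall|\gamma|\le p\}$, $\Phi'=\{(a,\xi,\lambda):(a,a,\xi,\lambda)\in\overline{\Delta\Phi}\}$, $\rho(\Phi)$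 fibrewise span of $\Phi'$; $\nabla^ph:=\rho^{2(r+1)}(\Phi_0)$ with $\Phi_0=\{(a,\lambda\delta_a,\lambda h(a))\}$. ''$\nabla^ph:\tau^p(Z)\to\mathbb{R}$'' means each $\xi\in\tau^p_a(Z)$ has exactly one $\lambda$ with $(a,\xi,\lambda)\in\nabla^ph$, denoted $\nabla^ph(\xi)$. For $b\in V$: $\varphi^*_b:\mathcal{P}_p(\mathbb{R}^n)\to\mathcal{P}_p(\mathbb{R}^m)$, $\varphi^*_b(P)=T^p_b(P\circ\varphi)$ (Taylor polynomial of order $p$ at $b$); $\varphi_{*b}$ is its dual map $\mathcal{P}_p(\mathbb{R}^m)^*\to\mathcal{P}_p(\mathbb{R}^n)^*$. *)

(* Defs.v *)
From HB Require Import structures.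
From mathcomp Require Import all_boot all_order all_algebra.
From mathcomp Require Import all_classical all_reals.
From mathcomp Require Import topology normedtype derive.
Set Implicit Arguments.
Unset Strict Implicit.
Unset Printing Implicit Defensive.
Import Order.TTheory GRing.Theory Num.Theory.
Import numFieldNormedType.Exports.
Local Open Scope ring_scope.
Local Open Scope classical_set_scope.

Section PolyJets.
Context {R : realType}.

Definition mi (d p : nat) := {g : {ffun 'I_d -> 'I_p.+1} | (\sum_i (g i : nat) <= p)%N}.
Definition mdeg d p (g : mi d p) : nat := (\sum_i (val g i : nat))%N.
Definition mfact d p (g : mi d p) : nat := (\prod_i (val g i : nat)`!)%N.
Definition mle d p (a g : mi d p) : bool := [forall i, (val a i <= val g i)%N].

(* P_p(R^d): a polynomial of degree <= p, given by its coefficients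
   in the monomial basis x^g, |g| <= p. *)
Definition Ppoly (d p : nat) := {ffun mi d p -> R}.
(* P_p(R^d)^*: a linear form zeta, given by its values zeta(x^g)
   on the monomial basis (canonical identification of the dual). *)
Definition Pdual (d p : nat) := {ffun mi d p -> R}.

Definition mono d p (g : mi d p) (x : 'rV[R]_d) : R := \prod_i x ord0 i ^+ (val g i).
Definition peval d p (P : Ppoly d p) (x : 'rV[R]_d) : R := \sum_g P g * mono g x.
Definition dapp d p (z : Pdual d p) (P : Ppoly d p) : R := \sum_g z g * P g.
Definition deltaP d p (a : 'rV[R]_d) : Pdual d p := [ffun g => mono g a].
Definition monoP d p (a : mi d p) : Ppoly d p := [ffun g => (g == a)%:R].
(* the polynomial (1/g!) (x - c)^g, expanded in the monomial basis *)
Definition shiftP d p (c : 'rV[R]_d) (g : mi d p) : Ppoly d p :=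
  [ffun a => if mle a g then
       (\prod_i ('C(val g i, val a i)%:R * (- c ord0 i) ^+ (val g i - val a i)%N))
         / (mfact g)%:R
     else 0].
Definition zcomp d p (z : Pdual d p) (c : 'rV[R]_d) (g : mi d p) : R := dapp z (shiftP c g).

Definition eucl_norm d (x : 'rV[R]_d) : R := Num.sqrt (\sum_i x ord0 i ^+ 2).
Definition dual_norm d p (z : Pdual d p) : R := \sum_g `|z g|.

Definition rdim (d p : nat) : nat := #|{: mi d p}|.

(* a bundle over Z with fibres in P_p^*  : a relation a |-> fibre E_a *)
Definition bundle d p := 'rV[R]_d -> Pdual d p -> Prop.

Definition E0 d p (Z : set 'rV[R]_d) : bundle d p :=
  fun a xi => Z a /\ exists l : R, xi = l *: deltaP p a.

Definition DeltaE d p (Z : set 'rV[R]_d) (E : bundle d p)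
  (a b : 'rV[R]_d) (z : Pdual d p) : Prop :=
  Z a /\ Z b /\ exists xi eta, E a xi /\ E b eta /\ z = xi + eta /\
    forall g : mi d p, eucl_norm (a - b) ^+ (p - mdeg g) * `|zcomp eta b g| <= 1.

(* E' = {(a,xi) : (a,a,xi) in closure of Delta E} (closure in R^d x R^d x P^* ) *)
Definition Eprime d p (Z : set 'rV[R]_d) (E : bundle d p) : bundle d p :=
  fun a xi => Z a /\ forall e : R, 0 < e -> exists a1 b1 z, DeltaE Z E a1 b1 z /\
     eucl_norm (a1 - a) < e /\ eucl_norm (b1 - a) < e /\ dual_norm (z - xi) < e.

Definition inspan d p (S : set (Pdual d p)) (xi : Pdual d p) : Prop :=
  exists (k : nat) (c : 'I_k -> R) (v : 'I_k -> Pdual d p),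
    (forall i, S (v i)) /\ xi = \sum_i c i *: v i.

Definition rhoP d p (Z : set 'rV[R]_d) (E : bundle d p) : bundle d p :=
  fun a xi => Z a /\ inspan (Eprime Z E a) xi.

Definition tauP d p (Z : set 'rV[R]_d) : bundle d p :=
  iter (2 * rdim d p) (rhoP Z) (@E0 d p Z).

Definition bundleR d p := 'rV[R]_d -> Pdual d p -> R -> Prop.

Definition Phi0 d p (Z : set 'rV[R]_d) (h : 'rV[R]_d -> R) : bundleR d p :=
  fun a xi lam => Z a /\ exists l : R, xi = l *: deltaP p a /\ lam = l * h a.

Definition DeltaPhi d p (Z : set 'rV[R]_d) (Phi : bundleR d p)
  (a b : 'rV[R]_d) (z : Pdual d p) (nu : R) : Prop :=
  Z a /\ Z b /\ exists xi l eta mu, Phi a xi l /\ Phi b eta mu /\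
    z = xi + eta /\ nu = l + mu /\
    forall g : mi d p, eucl_norm (a - b) ^+ (p - mdeg g) * `|zcomp eta b g| <= 1.

Definition Phiprime d p (Z : set 'rV[R]_d) (Phi : bundleR d p) : bundleR d p :=
  fun a xi lam => Z a /\ forall e : R, 0 < e -> exists a1 b1 z nu,
     DeltaPhi Z Phi a1 b1 z nu /\ eucl_norm (a1 - a) < e /\ eucl_norm (b1 - a) < e /\
     dual_norm (z - xi) < e /\ `|nu - lam| < e.

Definition rhoR d p (Z : set 'rV[R]_d) (Phi : bundleR d p) : bundleR d p :=
  fun a xi lam => Z a /\ exists (k : nat) (c : 'I_k -> R)
     (v : 'I_k -> Pdual d p) (w : 'I_k -> R),
     (forall i, Phiprime Z Phi a (v i) (w i)) /\
     xi = \sum_i c i *: v i /\ lam = \sum_i c i * w i.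

Definition nablaP d p (Z : set 'rV[R]_d) (h : 'rV[R]_d -> R) : bundleR d p :=
  iter (2 * (rdim d p).+1) (rhoR Z) (@Phi0 d p Z h).

Definition nablaP_is_fun d p (Z : set 'rV[R]_d) (h : 'rV[R]_d -> R) : Prop :=
  forall a xi, @tauP d p Z a xi -> exists! lam : R, @nablaP d p Z h a xi lam.

Definition ebase m (j : 'I_m) : 'rV[R]_m := delta_mx 0 j.
Definition pd m (j : 'I_m) (f : 'rV[R]_m -> R) : 'rV[R]_m -> R :=
  fun y => derive f y (ebase j).
Definition Dseq m (s : seq 'I_m) (f : 'rV[R]_m -> R) : 'rV[R]_m -> R :=
  foldr (fun j g => pd j g) f s.
Definition pdmi m p (be : mi m p) (f : 'rV[R]_m -> R) : 'rV[R]_m -> R :=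
  foldr (fun j g => iter (val be j) (pd j) g) f (enum 'I_m).

Definition Cp m (p : nat) (V : set 'rV[R]_m) (f : 'rV[R]_m -> R) : Prop :=
  forall s : seq 'I_m, (size s <= p)%N ->
    (forall y, V y -> {for y, continuous (Dseq s f)}) /\
    ((size s < p)%N -> forall j y, V y -> derivable (Dseq s f) y (ebase j)).

Definition Cpmap m n (p : nat) (V : set 'rV[R]_m) (phi : 'rV[R]_m -> 'rV[R]_n) : Prop :=
  forall i : 'I_n, Cp p V (fun y => phi y ord0 i).

Definition taylorP m p (h : 'rV[R]_m -> R) (b : 'rV[R]_m) : Ppoly m p :=
  \sum_(be : mi m p) pdmi be h b *: shiftP b be.

Definition pullP m n p (phi : 'rV[R]_m -> 'rV[R]_n) (b : 'rV[R]_m)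
  (P : Ppoly n p) : Ppoly m p := taylorP p (fun y => peval P (phi y)) b.

(* phi_{*b} : dual map of phi^*_b, (phi_{*b} eta)(x^a) = eta(phi^*_b(x^a)) *)
Definition pushD m n p (phi : 'rV[R]_m -> 'rV[R]_n) (b : 'rV[R]_m)
  (eta : Pdual m p) : Pdual n p := [ffun a => dapp eta (pullP phi b (monoP a))].

Definition closed_in_set d (U X : set 'rV[R]_d) : Prop :=
  X `<=` U /\ exists C, closed C /\ X = C `&` U.

End PolyJets.

(* Main.v *)
(** The push-forward carries the k-th Glaeser iterate over Y into the k-th
    iterate over X, for every k.  If xi + eta is an element of the paired bundle
    over (a, b), then
      phi_{*a} xi + phi_{*b} eta
        = phi_{*a} (xi + eta) + (phi_{*b} - phi_{*a}) eta,
    and the last term tends to 0: the coefficients of T_b h - T_a h in the basis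
    (x - b)^g / g! are o(|a - b|^(p - |g|)) for h = P o phi by Taylor's theorem,
    which is exactly what the constraint on eta absorbs.  The constraint itself
    is preserved up to a constant, because (phi - phi b)^g vanishes to order |g|
    at b and phi is locally Lipschitz.  Since the numbers of iterations over X
    and Y differ, one also needs that the iterates are constant from twice the
    fibre dimension on; this is Glaeser's rank argument.
    Pushing forward gives the uniqueness of the values of nabla^p g.  For their
    existence, values that were unbounded along an approximating sequence would,
    after division, put (b, 0, 1) in an iterate, contradicting uniqueness over X. *)
Require Import Defs.
From HB Require Import structures.
From mathcomp Require Import all_boot all_order all_algebra.
From mathcomp Require Import all_classical all_reals.
From mathcomp Require Import topology normedtype derive.
From mathcomp Require Import ring lra zify.
Set Implicit Arguments.
Unset Strict Implicit.
Unset Printing Implicit Defensive.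
Import Order.TTheory GRing.Theory Num.Theory.
Import numFieldNormedType.Exports.
Local Open Scope ring_scope.
Local Open Scope classical_set_scope.

(** * Partial derivatives and functions of class C^p *)


Section PartialDerivatives.
Context {R : realType}.

(** Because the constraint survives only up to a constant [C], the push-forward sends Phi' not into
    the corresponding prime over X but into [C] times it. The prime need not be stable under
    scaling; its fibrewise span is, so [C] disappears when the coefficients of the linear
    combinations are multiplied by it. The bundle tau^p is treated as the iterate belonging to the
    zero function, so that each argument is made once, for bundles with values. In the existence
    part, (b, 0, 1) has to be excluded at every stage k and not only at the last one, since the lift
    from stage k to k + 1 takes place inside the prime of stage k; stabilization over X covers all
    stages at once. Membership over X does not pull back to Y: the lift produces some value over Y,
    and uniqueness over X then identifies it. *)

Lemma norm_coord_le d (x : 'rV[R]_d) i : `|x ord0 i| <= `|x|.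
Proof.
rewrite [in leRHS]/Num.norm /= mx_normrE.
exact: (le_bigmax _ (fun ij : 'I_1 * 'I_d => `|x ij.1 ij.2|) (ord0, i)).
Qed.

Lemma norm_row_le d (x : 'rV[R]_d) (r : R) :
  0 <= r -> (forall i, `|x ord0 i| <= r) -> `|x| <= r.
Proof.
move=> r0 xr; rewrite [in leLHS]/Num.norm /= mx_normrE.
by apply/bigmax_leP; split=> // -[i j] _ /=; rewrite ord1.
Qed.

Lemma norm_row_lt d (x : 'rV[R]_d) (r : R) :
  0 < r -> (forall i, `|x ord0 i| < r) -> `|x| < r.
Proof.
move=> r0 xr; rewrite [in ltLHS]/Num.norm /= mx_normrE.
by apply/bigmax_ltP; split=> // -[i j] _ /=; rewrite ord1.
Qed.

(** The definitions measure distances with the Euclidean norm, the topology of row vectors with the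
    sup norm; this bound and [eucl_le_norm] are the bridge. *)
Lemma norm_le_eucl d (x : 'rV[R]_d) : `|x| <= eucl_norm x.
Proof.
apply: norm_row_le => [|i]; first exact: sqrtr_ge0.
rewrite /eucl_norm -sqrtr_sqr ler_sqrt; last by apply: sumr_ge0 => j _; exact: sqr_ge0.
by rewrite (bigD1 i) //= lerDl; apply: sumr_ge0 => j _; exact: sqr_ge0.
Qed.

Lemma eucl_le_norm d (x : 'rV[R]_d) : eucl_norm x <= d%:R * `|x|.
Proof.
rewrite /eucl_norm -[leRHS]ger0_norm; last by rewrite mulr_ge0.
rewrite -sqrtr_sqr ler_sqrt ?sqr_ge0 //.
apply: (@le_trans _ _ (\sum_(i < d) `|x| ^+ 2)).
  apply: ler_sum => i _; rewrite -[leLHS]real_normK ?num_real //.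
  by rewrite lerXn2r ?nnegrE // norm_coord_le.
rewrite sumr_const card_ord -[leLHS]mulr_natl exprMn ler_wpM2r ?sqr_ge0 //.
by case: d x => [|d] x; rewrite ?expr0n // -natrX ler_nat; lia.
Qed.

Lemma nbhs_rowP d (c : 'rV[R]_d) (P : set 'rV[R]_d) :
  nbhs c P <-> exists2 e : R, 0 < e & forall y, `|y - c| < e -> P y.
Proof.
split=> [/nbhs_ballP[e /= e0 H]|[e e0 H]].
  by exists e => // y yc; apply: H; rewrite -ball_normE /= distrC.
apply/nbhs_ballP; exists e => //= y; rewrite -ball_normE /= => yc.
by apply: H; rewrite distrC.
Qed.

Lemma continuous_rowP d (f : 'rV[R]_d -> R) (y : 'rV[R]_d) : {for y, continuous f} <->
  forall e : R, 0 < e ->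
    exists2 dl : R, 0 < dl & forall z, `|z - y| < dl -> `|f z - f y| < e.
Proof.
split=> [fc e e0|H].
  apply/nbhs_rowP; move: fc => /cvgrPdist_lt/(_ e e0) fc.
  near=> z; rewrite distrC; near: z; exact: fc.
rewrite /prop_for /continuous_at; apply/(@cvgrPdist_lt _ _ _ (nbhs y) (nbhs_filter y)) => e /H /nbhs_rowP fc.
by near=> z; rewrite distrC; near: z; exact: fc.
Unshelve. all: by end_near.
Qed.

Section Local.
Context {m : nat}.
Implicit Types (V : set 'rV[R]_m) (f g : 'rV[R]_m -> R) (s t : seq 'I_m).

(** Rules of differentiation give identities that hold on [V] only; as [V] is open, they can be
    differentiated again at its points. *)
Lemma pd_eq_on V f g j : open V -> {in V, f =1 g} -> {in V, pd j f =1 pd j g}.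
Proof.
move=> oV fg y; rewrite inE => Vy; apply: near_eq_derive.
near=> z; apply: fg; rewrite inE; near: z; exact: open_nbhs_nbhs.
Unshelve. all: by end_near. Qed.

Lemma derivable_eq_on V f g (v y : 'rV[R]_m) : open V -> {in V, f =1 g} -> V y ->
  derivable f y v -> derivable g y v.
Proof.
move=> oV fg Vy; apply: near_eq_derivable.
near=> z; apply: fg; rewrite inE; near: z; exact: open_nbhs_nbhs.
Unshelve. all: by end_near. Qed.

Lemma continuous_eq_on V f g y : open V -> {in V, f =1 g} -> V y ->
  {for y, continuous f} -> {for y, continuous g}.
Proof.
move=> oV fg Vy; rewrite /prop_for /continuous_at -(fg y) ?inE // => fc.
apply: cvg_trans fc; apply: (@near_eq_cvg _ _ (nbhs y) _ f g).
near=> z; apply: fg; rewrite inE; near: z; exact: open_nbhs_nbhs.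
Unshelve. all: by end_near. Qed.

Lemma Dseq_eq_on V f g s : open V -> {in V, f =1 g} -> {in V, Dseq s f =1 Dseq s g}.
Proof. by move=> oV fg; elim: s => //= j s; apply: pd_eq_on. Qed.

Lemma Dseq_cat s t f : Dseq (s ++ t) f = Dseq s (Dseq t f).
Proof. by rewrite /Dseq foldr_cat. Qed.

Lemma Dseq_rcons s j f : Dseq (rcons s j) f = Dseq s (pd j f).
Proof. by rewrite -cats1 Dseq_cat. Qed.

Lemma Cp_eq_on p V f g : open V -> {in V, f =1 g} -> Cp p V f -> Cp p V g.
Proof.
move=> oV fg Cf s sp; have [Cc Cd] := Cf s sp; have fgs := Dseq_eq_on s oV fg.
split=> [y Vy|sp' j y Vy].
  by apply: (continuous_eq_on oV fgs) => //; exact: Cc.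
by apply: (derivable_eq_on oV fgs) => //; exact: Cd.
Qed.

Lemma Cp_Dseq p q V f s : Cp p V f -> (size s + q <= p)%N -> Cp q V (Dseq s f).
Proof.
move=> Cf spq t tq; rewrite -Dseq_cat.
have ts : (size (t ++ s) <= p)%N by rewrite size_cat; lia.
have [Cc Cd] := Cf _ ts; split => // tq' j y Vy; apply: Cd => //.
by rewrite size_cat; lia.
Qed.

Lemma Cp_leq p q V f : (q <= p)%N -> Cp p V f -> Cp q V f.
Proof. by move=> qp Cf; apply: (@Cp_Dseq p q V f [::]). Qed.

Lemma Cp_continuous p V f : Cp p V f -> forall y, V y -> {for y, continuous f}.
Proof. by move=> /(_ [::] isT) []. Qed.

(** The derivative split off is the last entry of a sequence, that is, the one applied first. This
    makes the class a recursion on [p], and closure under products an induction through the Leibniz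
    rule. *)
Lemma CpSP p V f : Cp p.+1 V f <->
  [/\ forall y, V y -> {for y, continuous f},
      forall j y, V y -> derivable f y (ebase j) & forall j, Cp p V (pd j f)].
Proof.
split=> [Cf|[fc fd Cf]].
  split=> [|j y Vy|j]; first exact: Cp_continuous Cf.
    by have [_] := Cf [::] isT; apply.
  exact: (@Cp_Dseq p.+1 p V f [:: j]).
move=> s; case/lastP: s => [|s j] /=; first by [].
rewrite size_rcons ltnS Dseq_rcons => sp.
by have [Cc Cd] := Cf j s sp; split.
Qed.

Lemma Cp_cst p V (k : R) : open V -> Cp p V (fun=> k).
Proof.
move=> oV; elim: p k => [|p IH] k.
  by case=> //= _; split => // y _; exact: cst_continuous.
apply/CpSP; split=> [y _|j y _|j]; [exact: cst_continuous|exact: derivable_cst|].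
by apply: (Cp_eq_on oV _ (IH 0)) => y _; rewrite /pd derive_cst.
Qed.

Lemma CpD p V f g : open V -> Cp p V f -> Cp p V g -> Cp p V (fun y => f y + g y).
Proof.
move=> oV; elim: p f g => [|p IH] f g Cf Cg.
  case=> //= _; split => // y Vy; apply: (@continuousD _ _ _ f g).
    exact: Cp_continuous Cf _ Vy.
  exact: Cp_continuous Cg _ Vy.
have /CpSP[fc fd Cfj] := Cf; have /CpSP[gc gd Cgj] := Cg.
apply/CpSP; split=> [y Vy|j y Vy|j].
- by apply: (@continuousD _ _ _ f g); [exact: fc|exact: gc].
- by apply: (@derivableD _ _ _ f g); [exact: fd|exact: gd].
- apply: (Cp_eq_on oV _ (IH _ _ (Cfj j) (Cgj j))) => y; rewrite inE => Vy.
  by rewrite /pd (@deriveD _ _ _ f g) //; [exact: fd|exact: gd].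
Qed.

Lemma pdM_on V f g j : (forall y, V y -> derivable f y (ebase j)) ->
  (forall y, V y -> derivable g y (ebase j)) ->
  {in V, (fun y => f y * pd j g y + pd j f y * g y) =1 pd j (fun y => f y * g y)}.
Proof.
move=> fd gd y; rewrite inE => Vy.
rewrite /pd (@deriveM _ _ f g) //; [|exact: fd|exact: gd].
by rewrite /GRing.scale /= [in RHS]addrC [in RHS]addrC [g y * _]mulrC.
Qed.

Lemma CpM p V f g : open V -> Cp p V f -> Cp p V g -> Cp p V (fun y => f y * g y).
Proof.
move=> oV; elim: p f g => [|p IH] f g Cf Cg.
  case=> //= _; split => // y Vy; apply: (@continuousM _ _ f g).
    exact: Cp_continuous Cf _ Vy.
  exact: Cp_continuous Cg _ Vy.
have /CpSP[fc fd Cfj] := Cf; have /CpSP[gc gd Cgj] := Cg.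
apply/CpSP; split=> [y Vy|j y Vy|j].
- by apply: (@continuousM _ _ f g); [exact: fc|exact: gc].
- by apply: (@derivableM _ _ f g); [exact: fd|exact: gd].
- apply: (Cp_eq_on oV (pdM_on (fd j) (gd j))).
  by apply: CpD => //; apply: IH => //; exact: Cp_leq _ (leqnSn p) _.
Qed.

Lemma CpZ p V (k : R) f : open V -> Cp p V f -> Cp p V (fun y => k * f y).
Proof. by move=> oV; apply: CpM => //; exact: Cp_cst. Qed.

Lemma CpB p V f g : open V -> Cp p V f -> Cp p V g -> Cp p V (fun y => f y - g y).
Proof.
move=> oV Cf Cg; apply: (Cp_eq_on oV _ (CpD oV Cf (CpZ (-1) oV Cg))) => y _.
by rewrite mulN1r.
Qed.

Lemma Cp_sum p V (I : Type) (r : seq I) (F : I -> 'rV[R]_m -> R) : open V ->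
  (forall i, Cp p V (F i)) -> Cp p V (fun y => \sum_(i <- r) F i y).
Proof.
move=> oV CF; elim: r => [|i r IH].
  by apply: (Cp_eq_on oV _ (@Cp_cst p V 0 oV)) => y _; rewrite big_nil.
by apply: (Cp_eq_on oV _ (CpD oV (CF i) IH)) => y _; rewrite big_cons.
Qed.

Lemma Cp_prod p V (I : Type) (r : seq I) (F : I -> 'rV[R]_m -> R) : open V ->
  (forall i, Cp p V (F i)) -> Cp p V (fun y => \prod_(i <- r) F i y).
Proof.
move=> oV CF; elim: r => [|i r IH].
  by apply: (Cp_eq_on oV _ (@Cp_cst p V 1 oV)) => y _; rewrite big_nil.
by apply: (Cp_eq_on oV _ (CpM oV (CF i) IH)) => y _; rewrite big_cons.
Qed.

Lemma CpX p V f k : open V -> Cp p V f -> Cp p V (fun y => f y ^+ k).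
Proof.
move=> oV Cf; elim: k => [|k IH]; first exact: Cp_cst.
by apply: (Cp_eq_on oV _ (CpM oV Cf IH)) => y _; rewrite exprS.
Qed.

Lemma DseqD p V f g s : open V -> Cp p V f -> Cp p V g -> (size s <= p)%N ->
  {in V, Dseq s (fun y => f y + g y) =1 (fun y => Dseq s f y + Dseq s g y)}.
Proof.
move=> oV; elim: p s f g => [|p IH] s f g Cf Cg; first by case: s.
case/lastP: s => [|s j] //; rewrite size_rcons ltnS !Dseq_rcons => sp.
have /CpSP[_ fd Cfj] := Cf; have /CpSP[_ gd Cgj] := Cg.
move=> y Vy; rewrite -(IH s _ _ (Cfj j) (Cgj j)) //.
apply: (Dseq_eq_on _ oV) => // z; rewrite inE => Vz.
by rewrite /pd (@deriveD _ _ _ f g) //; [exact: fd|exact: gd].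
Qed.

Lemma DseqZ p V (k : R) f s : open V -> Cp p V f -> (size s <= p)%N ->
  {in V, Dseq s (fun y => k * f y) =1 (fun y => k * Dseq s f y)}.
Proof.
move=> oV; elim: p s f => [|p IH] s f Cf; first by case: s.
case/lastP: s => [|s j] //; rewrite size_rcons ltnS !Dseq_rcons => sp.
have /CpSP[_ fd Cfj] := Cf.
move=> y Vy; rewrite -(IH s _ (Cfj j)) //.
apply: (Dseq_eq_on _ oV) => // z; rewrite inE => Vz.
by rewrite /pd (@deriveZ _ _ _ f k) //; exact: fd.
Qed.

Lemma DseqB p V f g s : open V -> Cp p V f -> Cp p V g -> (size s <= p)%N ->
  {in V, Dseq s (fun y => f y - g y) =1 (fun y => Dseq s f y - Dseq s g y)}.
Proof.
move=> oV Cf Cg sp y Vy.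
rewrite -mulN1r -(DseqZ _ oV Cg) // -(DseqD oV Cf (CpZ _ oV Cg)) //.
by apply: (Dseq_eq_on _ oV) => // z _; rewrite mulN1r.
Qed.

Lemma Dseq_sum p V (I : Type) (r : seq I) (F : I -> 'rV[R]_m -> R) s : open V ->
  (forall i, Cp p V (F i)) -> (size s <= p)%N ->
  {in V, Dseq s (fun y => \sum_(i <- r) F i y) =1
         (fun y => \sum_(i <- r) Dseq s (F i) y)}.
Proof.
move=> oV CF sp y Vy; elim: r => [|i r IH].
  rewrite big_nil; have -> : (fun y => \sum_(i <- [::]) F i y) = (fun y => 0 * 0).
    by apply/funext => z; rewrite big_nil mul0r.
  by rewrite (DseqZ _ oV (@Cp_cst p V 0 oV)) // mul0r.
rewrite big_cons -IH -(DseqD oV (CF i) (Cp_sum _ oV CF)) //.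
by apply: (Dseq_eq_on _ oV) => // z _; rewrite big_cons.
Qed.

End Local.
End PartialDerivatives.

(** * Mean value inequality and symmetry of derivatives *)


Section MeanValue.
Context {R : realType}.

Lemma is_derive_line d (f : 'rV[R]_d -> R) (y v : 'rV[R]_d) (t : R) :
  derivable f (t *: v + y) v ->
  is_derive t 1 (fun t => f (t *: v + y)) ('D_v f (t *: v + y)).
Proof.
move=> fd.
have E : (fun h : R => h^-1 *: (((fun t => f (t *: v + y)) \o shift t) (h *: 1) -
                         f (t *: v + y))) =
         (fun h => h^-1 *: ((f \o shift (t *: v + y)) (h *: v) - f (t *: v + y))).
  apply/funext => h /=; congr (_ *: (f _ - _)).
  by rewrite scalerDl addrA; congr (_ *: _ + _ + _); rewrite /GRing.scale /= mulr1.
split; first by rewrite /derivable E.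
by rewrite /derive E.
Qed.

(** The sign of [L] is left free because the coordinate increments in [coord_MVT] have any sign;
    [th] is the relative position on the segment. *)
Lemma line_MVT d (f : 'rV[R]_d -> R) (y v : 'rV[R]_d) (L : R) :
  (forall th : R, 0 <= th <= 1 -> derivable f ((th * L) *: v + y) v) ->
  exists2 th : R, 0 <= th <= 1 &
    f (L *: v + y) - f y = L * 'D_v f ((th * L) *: v + y).
Proof.
move=> fd; have [L0|L0] := eqVneq L 0.
  by exists 0; rewrite ?lexx ?ler01 // L0 scale0r add0r subrr mul0r.
have fd' t : 0 <= t / L <= 1 -> derivable f (t *: v + y) v.
  by move=> /fd; rewrite divfK.
have H (a b : R) : (forall t, a <= t <= b -> 0 <= t / L <= 1) -> a <= b ->
  exists2 c, a <= c <= b & f (b *: v + y) - f (a *: v + y) =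
     'D_v f (c *: v + y) * (b - a).
  move=> ab aleb.
  have D x : a <= x <= b -> is_derive x 1 (fun t => f (t *: v + y)) ('D_v f (x *: v + y)).
    by move=> xab; apply: is_derive_line; apply: fd'; exact: ab.
  case: (@MVT_segment R (fun t => f (t *: v + y)) (fun t => 'D_v f (t *: v + y)) a b aleb).
  - move=> x; rewrite in_itv /= => /andP[ax xb]; apply: D.
    by rewrite !ltW.
  - by apply: derivable_within_continuous => x; rewrite in_itv /= => /D [].
  by move=> c; rewrite in_itv /= => cab E; exists c.
have [Lp|Ln] := ltP 0 L.
- have K t : 0 <= t <= L -> 0 <= t / L <= 1.
    by move=> /andP[t0 tL]; rewrite (divr_ge0 t0 (ltW Lp)) ler_pdivrMr // mul1r.
  have [c c0L E] := H 0 L K (ltW Lp).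
  exists (c / L); first exact: K.
  by move: E; rewrite divfK // scale0r add0r subr0 mulrC.
- have Ln' : L < 0 by rewrite lt_neqAle L0.
  have K t : L <= t <= 0 -> 0 <= t / L <= 1.
    move=> /andP[Lt t0]; rewrite ler_ndivrMr // mul1r Lt andbT.
    by rewrite -mulrNN -invrN divr_ge0 // oppr_ge0.
  have [c c0L E] := H L 0 K Ln.
  exists (c / L); first exact: K.
  move: E; rewrite divfK // scale0r add0r => E; apply: oppr_inj.
  by rewrite opprB E; ring.
Qed.

Lemma convex_comb_lt (p q th e : R) : 0 <= th -> th <= 1 -> p < e -> q < e ->
  (1 - th) * p + th * q < e.
Proof.
move=> th0 th1 pe qe; have [->|thn0] := eqVneq th 0; first by lra.
have B : 0 < th * (e - q) by rewrite mulr_gt0 ?subr_gt0 // lt_neqAle eq_sym thn0.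
have A : 0 <= (1 - th) * (e - p) by rewrite mulr_ge0 ?subr_ge0 // ltW.
by lra.
Qed.

(** The box with opposite corners [a], [b] and sides along the axes. It contains the staircase path
    of [coord_MVT], and a sup-norm ball that contains both corners contains the box. *)
Definition in_box d (a b y : 'rV[R]_d) :=
  forall i, exists2 th : R, 0 <= th <= 1 & y ord0 i = a ord0 i + th * (b ord0 i - a ord0 i).

Lemma in_box_norm d (a b y : 'rV[R]_d) : in_box a b y -> `|y - a| <= `|b - a|.
Proof.
move=> bx; apply: norm_row_le => // i; have [th /andP[th0 th1] E] := bx i.
rewrite !mxE E addrAC subrr add0r normrM ger0_norm //.
apply: (@le_trans _ _ `|b ord0 i - a ord0 i|); first by rewrite ler_piMl.
by have := norm_coord_le (b - a) i; rewrite !mxE.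
Qed.

Lemma in_box_ball d (a b y c : 'rV[R]_d) (e : R) :
  `|a - c| < e -> `|b - c| < e -> in_box a b y -> `|y - c| < e.
Proof.
move=> ac bc bx; apply: norm_row_lt => [|i]; first exact: le_lt_trans ac.
have [th /andP[th0 th1] E] := bx i.
have ai : `|a ord0 i - c ord0 i| < e.
  by apply: le_lt_trans ac; have := norm_coord_le (a - c) i; rewrite !mxE.
have bi : `|b ord0 i - c ord0 i| < e.
  by apply: le_lt_trans bc; have := norm_coord_le (b - c) i; rewrite !mxE.
rewrite !mxE E.
have -> : a ord0 i + th * (b ord0 i - a ord0 i) - c ord0 i =
  (1 - th) * (a ord0 i - c ord0 i) + th * (b ord0 i - c ord0 i) by ring.
apply: le_lt_trans (ler_normD _ _) _; rewrite !normrM (ger0_norm th0).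
rewrite (@ger0_norm _ (1 - th)) ?subr_ge0 //; exact: convex_comb_lt.
Qed.

(** Only partial derivatives are controlled, so [b] is reached from [a] by changing one coordinate
    at a time; [z k] has the first [k] coordinates of [b]. The factor [d] counts the steps. *)
Lemma coord_MVT d (u : 'rV[R]_d -> R) (a b : 'rV[R]_d) (B : R) :
  (forall j y, in_box a b y -> derivable u y (ebase j) /\ `|pd j u y| <= B) ->
  `|u b - u a| <= d%:R * (B * `|b - a|).
Proof.
move=> H.
pose z k : 'rV[R]_d := \row_i (if (i < k)%N then b ord0 i else a ord0 i).
have z0 : z 0%N = a by apply/rowP => i; rewrite mxE.
have zd : z d = b by apply/rowP => i; rewrite mxE ltn_ord.
have step (k : 'I_d) : `|u (z k.+1) - u (z k)| <= B * `|b - a|.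
  pose L := b ord0 k - a ord0 k.
  have zE : z k.+1 = L *: ebase k + z k.
    apply/rowP => i; rewrite !mxE eqxx /=.
    case: (ltngtP i k) => [ik|ik|/val_inj ->].
    - by rewrite (ltn_trans ik) // (_ : i == k = false) ?mulr0 ?add0r // -val_eqE /= ltn_eqF.
    - by rewrite ltnS leqNgt ik /= (_ : i == k = false) ?mulr0 ?add0r // -val_eqE /= gtn_eqF.
    - by rewrite ltnSn eqxx mulr1 subrK.
  have bx th : 0 <= th <= 1 -> in_box a b ((th * L) *: ebase k + z k).
    move=> th01 i; rewrite !mxE eqxx /=; case: (ltngtP i k) => [ik|ik|/val_inj ->].
    - exists 1; first by rewrite ler01 lexx.
      by rewrite (_ : i == k = false) ?mulr0 ?add0r -?val_eqE /= ?ltn_eqF // mul1r addrC subrK.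
    - exists 0; first by rewrite ler01 lexx.
      by rewrite (_ : i == k = false) ?mulr0 ?add0r -?val_eqE /= ?gtn_eqF // mul0r addr0.
    - by exists th => //; rewrite eqxx mulr1 addrC.
  rewrite zE; have [|th th01 ->] := @line_MVT d u (z k) (ebase k) L.
    by move=> th th01; have [] := H k _ (bx _ th01).
  rewrite normrM mulrC; apply: ler_pM => //.
    by have [_] := H k _ (bx _ th01).
  by have := norm_coord_le (b - a) k; rewrite !mxE.
rewrite -{1}zd -{1}z0 -(telescope_sumr (fun k => u (z k))) // big_mkord.
apply: le_trans (ler_norm_sum _ _ _) _.
apply: le_trans (ler_sum _ (fun k _ => step k)) _.
by rewrite sumr_const card_ord -[leLHS]mulr_natl.
Qed.

End MeanValue.

(** * Symmetry of mixed partial derivatives *)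

Section Schwarz.
Context {R : realType} {m : nat}.
Implicit Types (V : set 'rV[R]_m) (f : 'rV[R]_m -> R) (s t : seq 'I_m).

Lemma ebase_norm (j : 'I_m) : `|ebase j : 'rV[R]_m| <= 1.
Proof.
by apply: norm_row_le => // i; rewrite mxE eqxx /=; case: (_ == _); rewrite ?normr1 ?normr0.
Qed.

(* Both mixed derivatives are limits of the same second difference quotient. *)
Lemma second_difference V f (y : 'rV[R]_m) (i j : 'I_m) (e : R) :
  Cp 2 V f -> (forall z : 'rV[R]_m, `|z - y| < 2 * e -> V z) -> 0 < e ->
  exists2 z, `|z - y| < 2 * e &
    (e / 2) ^+ 2 * pd j (pd i f) z =
    (f ((e / 2) *: ebase j + ((e / 2) *: ebase i + y)) - f ((e / 2) *: ebase i + y))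
     - (f ((e / 2) *: ebase j + y) - f y).
Proof.
move=> Cf Vb e0; pose h := e / 2; have h0 : 0 < h by rewrite divr_gt0.
have /CpSP[_ fd Cf1] := Cf; have /CpSP[_ fdd _] := Cf1 i.
have near (s t : R) : 0 <= s <= 1 -> 0 <= t <= 1 ->
    `|(s * h) *: ebase j + ((t * h) *: ebase i + y) - y| < 2 * e.
  move=> /andP[s0 s1] /andP[t0 t1]; rewrite addrA addrK.
  apply: le_lt_trans (ler_normD _ _) _.
  have N (r : R) k : 0 <= r -> r <= 1 -> `|(r * h) *: ebase k : 'rV[R]_m| <= h.
    move=> r0 r1; rewrite normrZ normrM !ger0_norm ?(ltW h0) //.
    have := ebase_norm k; have := normr_ge0 (ebase k : 'rV[R]_m).
    set q := `|ebase k|; move=> q0 q1; have : r * h <= h by rewrite ler_piMl // ltW.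
    have : 0 <= r * h by rewrite mulr_ge0 // ltW.
    by nra.
  have := N s j s0 s1; have := N t i t0 t1; rewrite /h; lra.
(* The second difference is the increment of [F] along [ebase i]. The mean value theorem is applied
   to it, and then to [pd i f] along [ebase j]. *)
pose F (x : 'rV[R]_m) := f (h *: ebase j + x) - f x.
have Fd (t : R) : 0 <= t <= 1 -> is_derive ((t * h) *: ebase i + y) (ebase i) F
    (pd i f (h *: ebase j + ((t * h) *: ebase i + y)) - pd i f ((t * h) *: ebase i + y)).
  move=> t01; apply: (@is_deriveB _ _ _ (fun x => f (h *: ebase j + x)) f).
    have V1 : V (h *: ebase j + ((t * h) *: ebase i + y)).
      by apply: Vb; have := near 1 t; rewrite mul1r; apply => //; rewrite lexx ler01.
    have E : (fun k : R => k^-1 *: (((fun x => f (h *: ebase j + x)) \o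
         shift ((t * h) *: ebase i + y)) (k *: ebase i) - f (h *: ebase j + ((t * h) *: ebase i + y)))) =
       (fun k => k^-1 *: ((f \o shift (h *: ebase j + ((t * h) *: ebase i + y))) (k *: ebase i)
          - f (h *: ebase j + ((t * h) *: ebase i + y)))).
      by apply/funext => k /=; rewrite addrCA.
    by split; rewrite /pd /derivable /derive E; [exact: fd|].
  have V1 : V ((t * h) *: ebase i + y).
    apply: Vb; have := near 0 t; rewrite mul0r scale0r add0r; apply => //.
    by rewrite lexx ler01.
  by apply: derivableP; exact: fd.
have [t t01|t t01 E1] := @line_MVT R m F y (ebase i) h.
  by have [] := Fd t t01.
have [s s01|s s01 E2] := @line_MVT R m (pd i f) ((t * h) *: ebase i + y) (ebase j) h.
  by apply: fdd; apply: Vb; exact: near.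
exists ((s * h) *: ebase j + ((t * h) *: ebase i + y)); first exact: near.
have -> : pd j (pd i f) ((s * h) *: ebase j + ((t * h) *: ebase i + y)) =
   'D_(ebase j) (pd i f) ((s * h) *: ebase j + ((t * h) *: ebase i + y)) by [].
move: E1; rewrite /F -/h => ->; have [_ ->] := Fd t t01.
by rewrite E2 expr2 mulrA.
Qed.

Lemma pdC V f i j : open V -> Cp 2 V f -> {in V, pd i (pd j f) =1 pd j (pd i f)}.
Proof.
move=> oV Cf y; rewrite inE => Vy; apply/eqP; rewrite -subr_eq0; apply/eqP.
apply/normr0_eq0/le_anti; rewrite normr_ge0 andbT; apply/ler_addgt0Pl => e e0.
rewrite addr0.
have cij : {for y, continuous (pd i (pd j f))} by have [+ _] := Cf [:: i; j] isT; apply.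
have cji : {for y, continuous (pd j (pd i f))} by have [+ _] := Cf [:: j; i] isT; apply.
have e2 : 0 < e / 2 by rewrite divr_gt0.
have [d1 d10 H1] := proj1 (continuous_rowP _ _) cij _ e2.
have [d2 d20 H2] := proj1 (continuous_rowP _ _) cji _ e2.
have /nbhs_rowP[d3 d30 H3] := open_nbhs_nbhs (conj oV Vy).
pose d := Num.min d1 (Num.min d2 d3) / 2.
have d0 : 0 < d by rewrite divr_gt0 // !lt_min d10 d20.
have dE : 2 * d = Num.min d1 (Num.min d2 d3) by rewrite /d; field.
have Vb z : `|z - y| < 2 * d -> V z by rewrite dE !lt_min => /and3P[_ _]; exact: H3.
have [z1 z1y E1] := second_difference i j Cf Vb d0.
have [z2 z2y E2] := second_difference j i Cf Vb d0.
have E : pd j (pd i f) z1 = pd i (pd j f) z2.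
  apply: (@mulfI _ ((d / 2) ^+ 2)); first by rewrite expf_neq0 // gt_eqF // divr_gt0.
  by rewrite E1 E2 [(d / 2) *: ebase j + (_ + _)]addrCA; ring.
move: z1y z2y; rewrite dE !lt_min => /and3P[_ b1 _] /and3P[b2 _ _].
have := H1 _ b2; have := H2 _ b1; rewrite E.
move: (pd i (pd j f) y) (pd j (pd i f) y) (pd i (pd j f) z2) => A B C.
by rewrite !ltr_norml ler_norml => /andP[? ?] /andP[? ?]; apply/andP; split; lra.
Qed.

(** [move_out] carries one derivative from the innermost to the outermost place by exchanges with
    [pdC]; induction on [s] does the rest. The bound on [size s] keeps every function whose
    derivatives are exchanged of class C^2. *)
Lemma Dseq_perm p V f s t : open V -> Cp p V f -> (size s <= p)%N -> perm_eq s t ->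
  {in V, Dseq s f =1 Dseq t f}.
Proof.
move=> oV; elim: s t p f => [|i s IH] t p f Cf sp st.
  by rewrite perm_sym in st; move/perm_nilP: st => ->.
have move_out u g : Cp (size u).+1 V g -> {in V, Dseq (rcons u i) g =1 pd i (Dseq u g)}.
  elim: u => [|j u IHu] Cg y Vy //=.
  rewrite (pd_eq_on j oV (IHu (Cp_leq (leqnSn _) Cg)) Vy).
  by apply: (pdC _ _ oV) => //; apply: (Cp_Dseq Cg); rewrite /= addn2.
have it : i \in t by rewrite -(perm_mem st) mem_head.
have /splitPr E := it; case: t / E st it => t1 t2 st _.
have st' : perm_eq s (t1 ++ t2).
  by move: st; rewrite perm_sym -cat_rcons -cats1 -catA perm_catCA /= perm_cons perm_sym.
have sz : (size t1 + size t2 < p)%N by rewrite -size_cat -(perm_size st').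
move=> y Vy /=; rewrite -cat_rcons Dseq_cat move_out //; last first.
  by apply: (Cp_Dseq Cf); rewrite addnC addSn.
rewrite -Dseq_cat; apply: (pd_eq_on _ oV) => //.
by apply: (IH _ p) => //; exact: ltnW.
Qed.

End Schwarz.

(** * Polynomials and Taylor expansions *)


Section Polynomials.
Context {R : realType} {m : nat}.
Implicit Types (f : 'rV[R]_m -> R) (s : seq 'I_m).

(** Along a line in a coordinate direction, coordinates and monomials are univariate polynomials, so
    the derivative of [horner] can be used for them. *)
Lemma is_derive_of_line f (y v : 'rV[R]_m) (l : R) :
  is_derive (0 : R) (1 : R) (fun t : R => f (t *: v + y)) l -> is_derive y v f l.
Proof.
have E : (fun h : R => h^-1 *: (((fun t : R => f (t *: v + y)) \o shift 0) (h *: 1) -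
                         f (0 *: v + y))) =
         (fun h => h^-1 *: ((f \o shift y) (h *: v) - f y)).
  apply/funext => h /=; rewrite addr0 scale0r add0r; congr (_ *: (f (_ *: _ + _) - _)).
  by rewrite /GRing.scale /= mulr1.
by case; rewrite /derivable /derive E => d e; split.
Qed.

Lemma is_derive_coord (i j : 'I_m) (y : 'rV[R]_m) :
  is_derive y (ebase j) (fun x : 'rV[R]_m => x ord0 i) (i == j)%:R.
Proof.
apply: is_derive_of_line.
rewrite (_ : (fun t : R => _) = horner ((i == j)%:R *: 'X + (y ord0 i)%:P)).
  by apply: is_derive_eq; rewrite derivD derivZ derivX derivC addr0 !hornerE.
by apply/funext => t; rewrite !mxE !hornerE mulrC.
Qed.

Lemma Cp_coord p V (i : 'I_m) : open V -> Cp p V (fun x : 'rV[R]_m => x ord0 i).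
Proof.
move=> oV; case: p => [|p].
  by case=> //= _; split => // y _; exact: coord_continuous.
apply/CpSP; split=> [y _|j y _|j]; first exact: coord_continuous.
  by have [] := is_derive_coord i j y.
apply: (Cp_eq_on oV _ (@Cp_cst R m p V (i == j)%:R oV)) => y _.
by rewrite /pd; have [_ ->] := is_derive_coord i j y.
Qed.

(** Exponents are arbitrary functions rather than elements of [mi m p], so that differentiation
    lowers them without any bookkeeping on the degree. *)
Definition mpow (a : 'rV[R]_m) (e : 'I_m -> nat) (x : 'rV[R]_m) : R :=
  \prod_i (x ord0 i - a ord0 i) ^+ e i.

Lemma pd_mpow (k : R) a e j x :
  pd j (fun x => k * mpow a e x) x =
  k * ((e j)%:R * mpow a (fun i => e i - (i == j))%N x).
Proof.
pose C := k * \prod_(i | i != j) (x ord0 i - a ord0 i) ^+ e i.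
rewrite /pd; have [|_ ->] // := @is_derive_of_line (fun x => k * mpow a e x) x (ebase j)
   (k * ((e j)%:R * mpow a (fun i => e i - (i == j))%N x)).
rewrite (_ : (fun t : R => _) = horner (C *: ('X + (x ord0 j - a ord0 j)%:P) ^+ e j)).
  apply: is_derive_eq; rewrite derivZ deriv_exp derivD derivX derivC addr0 mul1r.
  rewrite hornerZ hornerMn horner_exp !hornerE /C /mpow [in RHS](bigD1 j) //= eqxx subn1.
  rewrite [in RHS](eq_bigr (fun i => (x ord0 i - a ord0 i) ^+ e i)); last first.
    by move=> i /negbTE ->; rewrite subn0.
  by rewrite -[_ *+ e j]mulr_natr; ring.
apply/funext => t; rewrite hornerZ horner_exp !hornerE /C /mpow [in LHS](bigD1 j) //= -mulrA.
congr (_ * _); rewrite mulrC; congr (_ * _ ^+ _).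
  by apply: eq_bigr => i /negbTE ij; rewrite !mxE eqxx ij /= mulr0 add0r.
by rewrite !mxE !eqxx /= mulr1.
Qed.

(** Truncated subtraction in the exponent does no harm: the falling factorial vanishes as soon as a
    coordinate is differentiated more often than its exponent allows. *)
Lemma Dseq_mpow s (k : R) a e :
  Dseq s (fun x => k * mpow a e x) =
  fun x => k * (\prod_i e i ^_ count_mem i s)%N%:R * mpow a (fun i => e i - count_mem i s)%N x.
Proof.
elim: s => [|j s IH] /=.
  apply/funext => x; rewrite big1 ?mulr1 //.
  by congr (_ * _); apply: eq_bigr => i _; rewrite subn0.
rewrite IH; apply/funext => x; rewrite pd_mpow -!mulrA; congr (_ * _).
rewrite mulrA -natrM; congr (_%:R * _).
  rewrite [in LHS](bigD1 j) //= [in RHS](bigD1 j) //= eqxx add1n ffactnSr.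
  rewrite mulnAC; congr (_ * _)%N; apply: eq_bigr => i ij.
  by rewrite eq_sym (negbTE ij).
apply: eq_bigr => i _; rewrite subnDA [j == i]eq_sym; congr (_ ^+ _).
by rewrite subnAC.
Qed.

(** Translates the multi-indices of [taylorP] into the sequences of directions in which [Cp] is
    phrased. *)
Definition mseq p (be : mi m p) : seq 'I_m :=
  flatten [seq nseq (val be j) j | j <- enum 'I_m].

Lemma pdmiE p (be : mi m p) f : pdmi be f = Dseq (mseq be) f.
Proof.
rewrite /pdmi /mseq; elim: (enum 'I_m) => //= j r IH.
by rewrite Dseq_cat -IH; elim: (nat_of_ord _) => //= k ->.
Qed.

Lemma count_mseq p (be : mi m p) i : count_mem i (mseq be) = val be i.
Proof.
rewrite /mseq count_flatten -map_comp sumnE big_map big_enum /= (bigD1 i) //=.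
rewrite count_nseq /= eqxx mul1n big1 ?addn0 // => j ij.
by rewrite count_nseq /= (negbTE ij).
Qed.

Lemma size_mseq p (be : mi m p) : size (mseq be) = mdeg be.
Proof.
rewrite /mseq size_flatten /shape -map_comp sumnE big_map big_enum /= /mdeg.
by apply: eq_bigr => i _; rewrite size_nseq.
Qed.

Lemma mdeg_le p (be : mi m p) : (mdeg be <= p)%N.
Proof. exact: (valP be). Qed.

Lemma size_mseq_le p (be : mi m p) : (size (mseq be) <= p)%N.
Proof. by rewrite size_mseq mdeg_le. Qed.

Lemma size_count s : size s = (\sum_i count_mem i s)%N.
Proof.
elim: s => [|j s IH] /=; first by rewrite big1.
rewrite big_split /= -IH (bigD1 j) //= eqxx big1 ?addn0 // => i ij.
by rewrite eq_sym (negbTE ij).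
Qed.

Lemma mseq_ex p s : (size s <= p)%N -> exists be : mi m p, perm_eq s (mseq be).
Proof.
move=> sp.
have cp i : (count_mem i s < p.+1)%N by rewrite ltnS (leq_trans (count_size _ _)).
pose g : {ffun 'I_m -> 'I_p.+1} := [ffun i => Ordinal (cp i)].
have gp : (\sum_i (g i : nat) <= p)%N.
  by rewrite (leq_trans _ sp) // size_count leq_sum // => i _; rewrite ffunE.
exists (exist _ g gp); apply/allP => i _ /=.
by rewrite count_mseq /= ffunE /=.
Qed.

Lemma shiftPE p (c : 'rV[R]_m) (g a : mi m p) : shiftP c g a =
  (mfact g)%:R^-1 * \prod_i ('C(val g i, val a i)%:R * (- c ord0 i) ^+ (val g i - val a i)%N).
Proof.
rewrite ffunE; case: ifP => [_|/forallP ag]; first by rewrite mulrC.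
have [i gi] : exists i, ~~ (val a i <= val g i)%N.
  by apply/existsP; rewrite -negb_forall; apply/negP => /forallP.
by rewrite (bigD1 i) //= bin_small ?mul0r ?mulr0 // ltnNge.
Qed.

Lemma sum_mi p (F : {ffun 'I_m -> 'I_p.+1} -> R) :
  \sum_(a : mi m p) F (val a) = \sum_(h : {ffun 'I_m -> 'I_p.+1} | (\sum_i (h i : nat) <= p)%N) F h.
Proof.
rewrite [RHS](@reindex_omap _ _ _ _ (mi m p) val insub) /=; last first.
  by move=> h hp; rewrite insubT.
by apply: eq_bigl => a; rewrite valK eqxx andbT; apply/esym; exact: (valP a).
Qed.

(** Binomial theorem in each coordinate, then distribution of the product over the sums. Exponents
    of total degree above [p] drop out: one of them exceeds the corresponding entry of [g], and its
    binomial coefficient is 0. *)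
Lemma peval_shiftP p (c : 'rV[R]_m) (g : mi m p) x :
  peval (shiftP c g) x = (mfact g)%:R^-1 * mpow c (fun i => val g i) x.
Proof.
pose F i (k : 'I_p.+1) : R := 'C(val g i, k)%:R * (- c ord0 i) ^+ (val g i - k) * x ord0 i ^+ k.
have -> : mpow c (fun i => val g i) x = \prod_i \sum_k F i k.
  apply: eq_bigr => i _; rewrite addrC exprDn.
  rewrite (big_ord_widen p.+1 (fun k => ((- c ord0 i) ^+ (val g i - k) * x ord0 i ^+ k) *+ 'C(val g i, k))) //.
  rewrite big_mkcond; apply: eq_bigr => k _; rewrite /F ltnS.
  case: leqP => kg; first by rewrite -[LHS]mulr_natl mulrA.
  by rewrite bin_small // !mul0r.
rewrite bigA_distr_bigA /= mulr_sumr.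
rewrite (bigID (fun h : {ffun 'I_m -> 'I_p.+1} => \sum_i (h i : nat) <= p)%N) /=.
rewrite [X in _ + X]big1 ?addr0.
  rewrite -(sum_mi (fun h => (mfact g)%:R^-1 * \prod_i F i (h i))).
  apply: eq_bigr => a _; rewrite shiftPE -mulrA; congr (_ * _).
  by rewrite -big_split.
move=> h hp; have [i gi] : exists i, ~~ (h i <= val g i)%N.
  apply/existsP; rewrite -negb_forall; apply: contra hp => /forallP hg.
  by apply: leq_trans (valP g); apply: leq_sum => i _; exact: hg.
by rewrite (bigD1 i) //= /F bin_small ?mul0r ?mulr0 // ltnNge.
Qed.

Lemma mfact_neq0 p (g : mi m p) : (mfact g)%:R != 0 :> R.
Proof.
rewrite pnatr_eq0 -lt0n; apply: prodn_gt0 => i; exact: fact_gt0.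
Qed.

(** Derivatives at [c] are the basis dual to [shiftP c]. Off the diagonal, either a coordinate is
    differentiated too often, or a factor vanishing at [c] is left over. *)
Lemma pdmi_shiftP p (c : 'rV[R]_m) (g be : mi m p) :
  pdmi be (peval (shiftP c g)) c = (g == be)%:R.
Proof.
rewrite pdmiE (_ : peval (shiftP c g) =
  fun x => (mfact g)%:R^-1 * mpow c (fun i => val g i) x); last first.
  by apply/funext => x; exact: peval_shiftP.
rewrite Dseq_mpow; have [->|gb] := eqVneq g be.
  rewrite /mpow [X in _ * X]big1 => [|i _]; last by rewrite count_mseq subnn.
  rewrite mulr1 (_ : (\prod_i _)%N = mfact be) ?mulVf ?mfact_neq0 //.
  by apply: eq_bigr => i _; rewrite count_mseq ffactnn.
have [i gi] : exists i, val g i != val be i.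
  apply/existsP; rewrite -negb_forall; apply: contra gb => /forallP H.
  by apply/eqP/val_inj/ffunP => i; apply/eqP.
case: (ltngtP (val g i) (val be i)) => [lt|lt|E]; last by rewrite -val_eqE /= E eqxx in gi.
  by rewrite (bigD1 i) //= count_mseq ffact_small // mul0n mulr0 mul0r.
rewrite /mpow [X in _ * X](bigD1 i) //= count_mseq subrr expr0n.
by rewrite subn_eq0 leqNgt lt /= mul0r mulr0.
Qed.

(** After [p] derivatives of a monomial of degree at most [p], either the result is 0 or no variable
    is left. *)
Lemma Dseq_top_shiftP p (c : 'rV[R]_m) (g : mi m p) s x y : size s = p ->
  Dseq s (peval (shiftP c g)) x = Dseq s (peval (shiftP c g)) y.
Proof.
move=> sp; rewrite (_ : peval (shiftP c g) =
  fun x => (mfact g)%:R^-1 * mpow c (fun i => val g i) x); last first.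
  by apply/funext => z; exact: peval_shiftP.
rewrite Dseq_mpow; case: (boolP [forall i, count_mem i s <= val g i]%N) => [/forallP H|].
  suff E i : (val g i - count_mem i s = 0)%N.
    by congr (_ * _); apply: eq_bigr => i _; rewrite E.
  have : (\sum_i (val g i - count_mem i s) = 0)%N.
    rewrite sumnB // -size_count sp; apply/eqP; rewrite subn_eq0; exact: (valP g).
  by move=> /eqP; rewrite sum_nat_eq0 => /forallP/(_ i)/eqP.
rewrite negb_forall => /existsP[i]; rewrite -ltnNge => lt.
by rewrite (bigD1 i) //= ffact_small // mul0n mulr0 !mul0r.
Qed.

Lemma peval_lin p (I : Type) (r : seq I) (k : I -> R) (Q : I -> @Ppoly R m p) x :
  peval (\sum_(i <- r) k i *: Q i) x = \sum_(i <- r) k i * peval (Q i) x.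
Proof.
rewrite /peval; under [RHS]eq_bigr do rewrite mulr_sumr.
rewrite exchange_big /=; apply: eq_bigr => g _.
rewrite sum_ffunE mulr_suml; apply: eq_bigr => i _.
by rewrite !ffunE /GRing.scale /= mulrA.
Qed.

Lemma Ppoly_mono p (P : @Ppoly R m p) : P = \sum_g P g *: monoP g.
Proof.
apply/ffunP => g; rewrite sum_ffunE (bigD1 g) //= !ffunE eqxx big1 => [|h hg].
  by rewrite /GRing.scale /= mulr1 addr0.
by rewrite !ffunE eq_sym (negbTE hg) /GRing.scale /= mulr0.
Qed.

Lemma peval_monoP p (g : mi m p) (x : 'rV[R]_m) : peval (monoP g) x = mono g x.
Proof.
rewrite /peval (bigD1 g) //= ffunE eqxx mul1r big1 ?addr0 // => h hg.
by rewrite ffunE (negbTE hg) mul0r.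
Qed.

Lemma Cp_peval_comp d p q (V : set 'rV[R]_m) (phi : 'rV[R]_m -> 'rV[R]_d) (P : @Ppoly R d q) :
  open V -> Cpmap p V phi -> Cp p V (fun y => peval P (phi y)).
Proof.
move=> oV Cphi; apply: Cp_sum => // g; apply: CpZ => //; apply: Cp_prod => // i.
by apply: CpX => //; exact: Cphi.
Qed.

Lemma Cp_peval p q (P : @Ppoly R m q) V : open V -> Cp p V (peval P).
Proof.
move=> oV; apply: (@Cp_peval_comp m p q V id) => // i; exact: Cp_coord.
Qed.

Lemma pdmi_lin p V (be : mi m p) (I : Type) (r : seq I) (k : I -> R)
    (F : I -> 'rV[R]_m -> R) y : open V -> V y -> (forall i, Cp p V (F i)) ->
  pdmi be (fun y => \sum_(i <- r) k i * F i y) y = \sum_(i <- r) k i * pdmi be (F i) y.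
Proof.
move=> oV Vy CF; rewrite pdmiE (Dseq_sum _ oV (p := p)) ?inE ?size_mseq_le //.
  by apply: eq_bigr => i _; rewrite (DseqZ _ oV (CF i)) ?inE ?size_mseq_le // pdmiE.
by move=> i; exact: CpZ.
Qed.

(* The matrices of (shiftP b g) in the monomial basis and of the derivatives of
   monomials at b are inverse to each other on one side, hence on both. *)
Lemma taylorP_peval p (b : 'rV[R]_m) (Q : @Ppoly R m p) : taylorP p (peval Q) b = Q.
Proof.
pose N := #|{: mi m p}|.
pose A : 'M[R]_N := \matrix_(i, j) shiftP b (enum_val i) (enum_val j).
pose B : 'M[R]_N := \matrix_(i, j) pdmi (enum_val j) (peval (monoP (enum_val i))) b.
have oT : open [set: 'rV[R]_m] := openT.
have pe (P : @Ppoly R m p) : peval P = fun y => \sum_g P g * peval (monoP g) y.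
  by apply/funext => y; rewrite {1}(Ppoly_mono P) peval_lin.
have AB : A *m B = 1%:M.
  apply/matrixP => i j; rewrite !mxE.
  rewrite -(inj_eq enum_val_inj) -(pdmi_shiftP b) pe (pdmi_lin _ _ _ oT) //; last first.
    by move=> g; exact: Cp_peval.
  rewrite [RHS](reindex_onto (@enum_val _ (mem {: mi m p})) enum_rank) /=; last first.
    by move=> g _; rewrite enum_rankK.
  by apply: eq_big => [k|k _]; rewrite ?enum_valK ?eqxx // !mxE.
have taylor_mono g : taylorP p (peval (monoP g)) b = monoP g.
  have := mulmx1C AB => /matrixP BA; apply/ffunP => h; rewrite sum_ffunE.
  have := BA (enum_rank g) (enum_rank h).
  rewrite !mxE (inj_eq enum_rank_inj) [monoP g h]ffunE eq_sym => <-.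
  rewrite [LHS](reindex_onto (@enum_val _ (mem {: mi m p})) enum_rank) /=; last first.
    by move=> g' _; rewrite enum_rankK.
  apply: eq_big => [k|k _]; rewrite ?enum_valK ?eqxx // !mxE !enum_rankK.
  by rewrite [LHS]ffunE.
rewrite /taylorP [RHS]Ppoly_mono pe.
under eq_bigr => be _ do (rewrite (pdmi_lin _ _ _ oT) //; last by move=> g; exact: Cp_peval).
under eq_bigr => be _ do rewrite scaler_suml.
rewrite exchange_big /=; apply: eq_bigr => g _.
rewrite -[in RHS](taylor_mono g) /taylorP scaler_sumr.
by apply: eq_bigr => be _; rewrite scalerA.
Qed.

End Polynomials.


(** * Taylor remainder and order of vanishing *)

Section Taylor.
Context {R : realType} {m : nat}.
Implicit Types (f g : 'rV[R]_m -> R) (s : seq 'I_m) (V : set 'rV[R]_m).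

Lemma ball_forall (I : finType) (c : 'rV[R]_m) (P : I -> 'rV[R]_m -> Prop) :
  (forall i, exists2 e : R, 0 < e & forall y, `|y - c| < e -> P i y) ->
  exists2 e : R, 0 < e & forall y, `|y - c| < e -> forall i, P i y.
Proof.
move=> H; have /fin_all_exists2[e e0 He] := H.
exists (\big[Num.min/1]_i e i); first by elim/big_ind: _ => // x y x0 y0; rewrite lt_min x0.
move=> y yc i; apply: He; apply: lt_le_trans yc _.
by rewrite (bigD1 i) //= ge_min lexx.
Qed.

Lemma peval_taylorP p f a x :
  peval (taylorP p f a) x = \sum_(g : mi m p) pdmi g f a * peval (shiftP a g) x.
Proof. exact: peval_lin. Qed.

Lemma Dseq_taylorP p V f a s : open V -> Cp p V f -> V a -> (size s <= p)%N ->
  Dseq s (peval (taylorP p f a)) a = Dseq s f a.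
Proof.
move=> oV Cf Va sp; have [be sbe] := mseq_ex sp.
have Va' : a \in V by rewrite inE.
rewrite (Dseq_perm oV (Cp_peval (p := p) (taylorP p f a) oV) sp sbe Va').
rewrite (Dseq_perm oV Cf sp sbe Va') -!pdmiE.
rewrite (_ : peval _ = fun x => \sum_(g : mi m p) pdmi g f a * peval (shiftP a g) x); last first.
  by apply/funext => x; exact: peval_taylorP.
rewrite (pdmi_lin _ _ _ openT) //; last by move=> g; exact/Cp_peval/openT.
rewrite (bigD1 be) //= pdmi_shiftP eqxx mulr1 big1 ?addr0 // => g gbe.
by rewrite pdmi_shiftP (negbTE gbe) mulr0.
Qed.

Lemma Dseq_top_taylorP p f a s x y : size s = p ->
  Dseq s (peval (taylorP p f a)) x = Dseq s (peval (taylorP p f a)) y.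
Proof.
move=> sp.
rewrite (_ : peval _ = fun x => \sum_(g : mi m p) pdmi g f a * peval (shiftP a g) x); last first.
  by apply/funext => z; exact: peval_taylorP.
have oT := @openT 'rV[R]_m.
have CF (g : mi m p) : Cp p setT (fun z => pdmi g f a * peval (shiftP a g) z).
  by apply: CpZ => //; exact: Cp_peval.
rewrite !(Dseq_sum _ oT CF) ?inE ?sp //; apply: eq_bigr => g _.
rewrite !(DseqZ _ oT (Cp_peval (p := p) (shiftP a g) oT)) ?inE ?sp //; congr (_ * _).
exact: Dseq_top_shiftP.
Qed.

(* Descending induction on the order of differentiation: the derivatives of
   order p of the remainder are small by continuity, and the lower ones vanish
   at a, so the mean value inequality gains one power of |y - a| at each step. *)
Lemma taylor_remainder p V f c (e : R) : open V -> Cp p V f -> V c -> 0 < e ->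
  exists2 dl : R, 0 < dl & forall a b, `|a - c| < dl -> `|b - c| < dl ->
    forall be : mi m p,
    `|pdmi be (fun x => f x - peval (taylorP p f a) x) b| <= e * `|b - a| ^+ (p - mdeg be).
Proof.
(* [M] dominates the factor [m] that each use of [coord_MVT] costs and is at least 1 even for
   [m = 0]; dividing [e] by [M ^+ p] pays for at most [p] uses. *)
move=> oV Cf Vc e0; pose M : R := m.+1%:R; have M1 : 1 <= M by rewrite ler1n.
have M0 : 0 < M by apply: lt_le_trans M1.
pose e1 := e / M ^+ p; have e10 : 0 < e1 by rewrite divr_gt0 // exprn_gt0.
have e12 : 0 < e1 / 2 by rewrite divr_gt0.
have cont (be : mi m p) : exists2 dl : R, 0 < dl &
    forall y, `|y - c| < dl -> `|pdmi be f y - pdmi be f c| < e1 / 2.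
  have fc : {for c, continuous (pdmi be f)}.
    by rewrite pdmiE; have [+ _] := Cf _ (size_mseq_le be); apply.
  exact: (proj1 (continuous_rowP _ _) fc).
have [d1 d10 H1] := ball_forall cont.
have /nbhs_rowP[d2 d20 H2] := open_nbhs_nbhs (conj oV Vc).
exists (Num.min d1 d2); first by rewrite lt_min d10.
move=> a b; rewrite !lt_min => /andP[a1 a2] /andP[b1 b2] be.
set u := fun x => _; have Va := H2 _ a2.
have Cu : Cp p V u by apply: CpB => //; exact: Cp_peval.
have uE s y : (size s <= p)%N -> V y ->
    Dseq s u y = Dseq s f y - Dseq s (peval (taylorP p f a)) y.
  by move=> sp Vy; rewrite (DseqB oV Cf (Cp_peval (p := p) _ oV)) // inE.
have claim k s y : (size s + k = p)%N -> `|y - c| < d1 -> `|y - c| < d2 ->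
    `|Dseq s u y| <= M ^+ k * e1 * `|y - a| ^+ k.
  elim: k s y => [|k IH] s y sk y1 y2; have Vy := H2 _ y2.
    (* At top order the derivatives of the Taylor polynomial are constant and equal those of [f] at
       [a]; comparing [y] and [a] with [c] costs [e1 / 2] each. *)
    rewrite addn0 in sk; rewrite !expr0 mul1r mulr1 uE ?sk //.
    rewrite (Dseq_top_taylorP _ _ _ a) // (Dseq_taylorP oV) ?sk //.
    have sp : (size s <= p)%N by rewrite sk.
    have [ga sga] := mseq_ex sp.
    have -> : Dseq s f y = pdmi ga f y.
      by rewrite pdmiE (Dseq_perm oV Cf sp sga) // inE.
    have -> : Dseq s f a = pdmi ga f a.
      by rewrite pdmiE (Dseq_perm oV Cf sp sga) // inE.
    have := H1 _ y1 ga; have := H1 _ a1 ga.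
    move: (pdmi ga f a) (pdmi ga f y) (pdmi ga f c) => A B C.
    by rewrite !ltr_norml ler_norml => /andP[? ?] /andP[? ?]; apply/andP; split; lra.
  have sp : (size s <= p)%N by rewrite -sk leq_addr.
  have ua0 : Dseq s u a = 0 by rewrite uE // (Dseq_taylorP oV) // subrr.
  rewrite -[Dseq s u y]subr0 -ua0.
  apply: (@le_trans _ _ (m%:R * ((M ^+ k * e1 * `|y - a| ^+ k) * `|y - a|))).
    apply: coord_MVT => j z bx; have zc1 := in_box_ball a1 y1 bx.
    have zc2 := in_box_ball a2 y2 bx; split.
      have [_ +] := Cu s sp; apply; [by rewrite -sk addnS ltnS leq_addr|exact: H2].
    apply: (@le_trans _ _ (M ^+ k * e1 * `|z - a| ^+ k)).
      by apply: (IH (j :: s)) => //=; rewrite addSnnS.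
    apply: ler_wpM2l; first by rewrite mulr_ge0 ?exprn_ge0 // ltW.
    by rewrite lerXn2r ?nnegrE // in_box_norm.
  rewrite [M ^+ k.+1]exprS [`|y - a| ^+ k.+1]exprSr.
  set w := M ^+ k * e1 * _ * _; have w0 : 0 <= w.
    apply: mulr_ge0 => //; apply: mulr_ge0; last exact: exprn_ge0.
    by apply: mulr_ge0; [exact/exprn_ge0/ltW|exact: ltW].
  have -> : M * M ^+ k * e1 * (`|y - a| ^+ k * `|y - a|) = M * w by rewrite /w; ring.
  by apply: ler_wpM2r => //; rewrite ler_nat.
rewrite pdmiE; have sb := size_mseq be; have mb := mdeg_le be.
apply: le_trans (claim (p - mdeg be)%N _ _ _ b1 b2) _; first by rewrite sb subnKC.
apply: ler_wpM2r; first exact: exprn_ge0.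
rewrite /e1 mulrCA -[leRHS]mulr1; apply: ler_wpM2l; first exact: ltW.
by rewrite ler_pdivrMr ?exprn_gt0 // mul1r ler_weXn2l // leq_subr.
Qed.

(** Vanishing to order [k] at [b], tested only on the derivatives of order at most [p] that a
    function of class C^p has. *)
Definition flat p k f (b : 'rV[R]_m) :=
  forall s, (size s <= p)%N -> (size s < k)%N -> Dseq s f b = 0.

(** By the Leibniz rule: differentiating one factor lowers its order of vanishing by at most one and
    keeps that of the other. *)
Lemma flatM p V f g j k b : open V -> V b -> Cp p V f -> Cp p V g ->
  flat p j f b -> flat p k g b -> flat p (j + k) (fun y => f y * g y) b.
Proof.
move=> oV Vb; elim: p f g j k => [|p IH] f g j k Cf Cg ff fg s.
  case: s => //= _ jk; case: j jk ff => [|j] jk ff; last by rewrite [f b](ff [::]) ?mul0r.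
  by rewrite [g b](fg [::]) ?mulr0.
have Vb' : b \in V by rewrite inE.
case/lastP: s => [_ jk|s i].
  rewrite /=; case: j jk ff => [|j] jk ff; last by rewrite [f b](ff [::]) ?mul0r.
  by rewrite [g b](fg [::]) ?mulr0.
rewrite size_rcons ltnS => sp sjk; rewrite Dseq_rcons.
have /CpSP[_ fd Cfi] := Cf; have /CpSP[_ gd Cgi] := Cg.
have Cf' := Cp_leq (leqnSn p) Cf; have Cg' := Cp_leq (leqnSn p) Cg.
rewrite -(Dseq_eq_on s oV (pdM_on (fd i) (gd i)) Vb').
rewrite (DseqD oV (CpM oV Cf' (Cgi i)) (CpM oV (Cfi i) Cg')) //.
rewrite (IH _ _ j k.-1 Cf' (Cgi i)) //; last by lia.
- rewrite (IH _ _ j.-1 k (Cfi i) Cg') ?addr0 //; last by lia.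
  + by move=> t tp tj; rewrite -Dseq_rcons ff ?size_rcons //; lia.
  + by move=> t tp tj; apply: fg => //; lia.
- by move=> t tp tj; apply: ff => //; lia.
- by move=> t tp tj; rewrite -Dseq_rcons fg ?size_rcons //; lia.
Qed.

Lemma flat_exp p V f b e : open V -> V b -> Cp p V f -> f b = 0 ->
  flat p e (fun y => f y ^+ e) b.
Proof.
move=> oV Vb Cf f0; elim: e => [|e IH] //.
rewrite (_ : (fun y => f y ^+ e.+1) = fun y => f y * f y ^+ e); last first.
  by apply/funext => y; rewrite exprS.
rewrite -add1n; apply: (flatM oV Vb Cf) => //; first exact: CpX.
by case.
Qed.

Lemma flat_prod p V (I : Type) (r : seq I) (F : I -> 'rV[R]_m -> R) (k : I -> nat) b :
  open V -> V b -> (forall i, Cp p V (F i)) -> (forall i, flat p (k i) (F i) b) ->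
  flat p (\sum_(i <- r) k i)%N (fun y => \prod_(i <- r) F i y) b.
Proof.
move=> oV Vb CF fF; elim: r => [|i r IH]; first by rewrite big_nil.
rewrite big_cons (_ : (fun y => _) = fun y => F i y * \prod_(i <- r) F i y); last first.
  by apply/funext => y; rewrite big_cons.
by apply: (flatM oV Vb) => //; exact: Cp_prod.
Qed.

End Taylor.

(** * Push-forward of linear forms on polynomials *)


Section Pushforward.
Context {R : realType}.

Lemma dapp_lin d p (I : Type) (r : seq I) (k : I -> R) (z : Pdual d p) (Q : I -> @Ppoly R d p) :
  dapp z (\sum_(i <- r) k i *: Q i) = \sum_(i <- r) k i * dapp z (Q i).
Proof.
rewrite /dapp; under [RHS]eq_bigr do rewrite mulr_sumr.
rewrite exchange_big /=; apply: eq_bigr => g _.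
rewrite sum_ffunE mulr_sumr; apply: eq_bigr => i _.
by rewrite !ffunE /GRing.scale /= mulrCA.
Qed.

Lemma dappB d p (z : Pdual d p) (P Q : @Ppoly R d p) : dapp z (P - Q) = dapp z P - dapp z Q.
Proof. by rewrite /dapp -sumrB; apply: eq_bigr => g _; rewrite !ffunE mulrBr. Qed.

Lemma dapp_linl d p (c : R) (z1 z2 : Pdual d p) (P : @Ppoly R d p) :
  dapp (c *: z1 + z2) P = c * dapp z1 P + dapp z2 P.
Proof.
rewrite /dapp mulr_sumr -big_split; apply: eq_bigr => g _ /=.
by rewrite !ffunE /GRing.scale /=; ring.
Qed.

Lemma dapp_taylorP d p h (b : 'rV[R]_d) (eta : Pdual d p) :
  dapp eta (taylorP p h b) = \sum_be pdmi be h b * zcomp eta b be.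
Proof. exact: dapp_lin. Qed.

Lemma dual_norm_ge0 d p (z : @Pdual R d p) : 0 <= dual_norm z.
Proof. by apply: sumr_ge0. Qed.

Lemma dual_normD d p (z w : @Pdual R d p) : dual_norm (z + w) <= dual_norm z + dual_norm w.
Proof. by rewrite -big_split; apply: ler_sum => g _; rewrite ffunE ler_normD. Qed.

Lemma dual_normZ d p (c : R) (z : @Pdual R d p) : dual_norm (c *: z) = `|c| * dual_norm z.
Proof. by rewrite /dual_norm mulr_sumr; apply: eq_bigr => g _; rewrite ffunE normrM. Qed.

Lemma zcompZ d p (c : R) (z : @Pdual R d p) b g : zcomp (c *: z) b g = c * zcomp z b g.
Proof.
have := dapp_linl c z 0 (shiftP b g); rewrite addr0 /zcomp => ->.
by rewrite /dapp [X in _ + X]big1 ?addr0 // => h _; rewrite ffunE mul0r.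
Qed.

Context {m n p : nat} (V : set 'rV[R]_m) (phi : 'rV[R]_m -> 'rV[R]_n).
Hypotheses (oV : open V) (Cphi : Cpmap p V phi).

Lemma pushD_lin b (c : R) (eta1 eta2 : Pdual m p) :
  pushD phi b (c *: eta1 + eta2) = c *: pushD phi b eta1 + pushD phi b eta2.
Proof. by apply/ffunP => a; rewrite !ffunE dapp_linl. Qed.

Lemma pushDZ b (c : R) (eta : Pdual m p) : pushD phi b (c *: eta) = c *: pushD phi b eta.
Proof.
apply/ffunP => a; rewrite !ffunE /dapp /GRing.scale /= mulr_sumr.
by apply: eq_bigr => g _; rewrite ffunE /GRing.scale /= mulrA.
Qed.

Lemma pushDD b (eta1 eta2 : Pdual m p) :
  pushD phi b (eta1 + eta2) = pushD phi b eta1 + pushD phi b eta2.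
Proof. by have := pushD_lin b 1 eta1 eta2; rewrite !scale1r. Qed.

Lemma pushD_sum b k (c : 'I_k -> R) (v : 'I_k -> Pdual m p) :
  pushD phi b (\sum_i c i *: v i) = \sum_i c i *: pushD phi b (v i).
Proof.
elim/big_rec2: _ => [|i y z _ <-]; last by rewrite pushDD pushDZ.
by have := pushDZ b 0 0; rewrite !scale0r.
Qed.

Lemma Cp_mono_comp (al : mi n p) : Cp p V (fun y => peval (monoP al) (phi y)).
Proof. exact: Cp_peval_comp. Qed.

Lemma pullP_mono b (P : @Ppoly R n p) : V b ->
  pullP phi b P = \sum_al P al *: pullP phi b (monoP al).
Proof.
move=> Vb; rewrite /pullP /taylorP.
rewrite (_ : (fun y => peval P (phi y)) =
   fun y => \sum_al P al * peval (monoP al) (phi y)); last first.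
  by apply/funext => y; rewrite {1}(Ppoly_mono P) peval_lin.
under eq_bigr => be _ do (rewrite (pdmi_lin _ _ _ oV) //; last exact: Cp_mono_comp).
under eq_bigr => be _ do rewrite scaler_suml.
rewrite exchange_big /=; apply: eq_bigr => al _.
by rewrite scaler_sumr; apply: eq_bigr => be _; rewrite scalerA.
Qed.

Lemma dapp_pushD b (eta : Pdual m p) (P : @Ppoly R n p) : V b ->
  dapp (pushD phi b eta) P = dapp eta (pullP phi b P).
Proof.
move=> Vb; rewrite pullP_mono // dapp_lin /dapp; apply: eq_bigr => al _.
by rewrite ffunE mulrC.
Qed.

(** A Taylor polynomial at [b] takes the value of the function at [b]: in its expansion at [b] only
    the zero multi-index [z] survives. *)
Lemma pushD_delta b : pushD phi b (deltaP p b) = deltaP p (phi b).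
Proof.
apply/ffunP => al; rewrite !ffunE -peval_monoP.
rewrite (_ : dapp _ _ = peval (pullP phi b (monoP al)) b); last first.
  by apply: eq_bigr => g _; rewrite ffunE mulrC.
rewrite /pullP peval_taylorP.
have z0 : (\sum_(i < m) (([ffun=> ord0] : {ffun 'I_m -> 'I_p.+1}) i : nat) <= p)%N.
  by rewrite big1 // => i _; rewrite ffunE.
pose z : mi m p := exist (fun g : {ffun 'I_m -> 'I_p.+1} => (\sum_i (g i : nat) <= p)%N) _ z0.
have pe0 (g : mi m p) : peval (shiftP b g) b = (g == z)%:R.
  rewrite peval_shiftP; have [->|gz] := eqVneq g z.
    rewrite /mpow /mfact !big1 ?invr1 ?mulr1 // => i _; by rewrite ffunE.
  have [i gi] : exists i, val g i != ord0.
    apply/existsP; rewrite -negb_forall; apply: contra gz => /forallP H.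
    by apply/eqP/val_inj/ffunP => i; rewrite ffunE; apply/eqP.
  rewrite -val_eqE /= in gi.
  by rewrite /mpow (bigD1 i) //= subrr expr0n (negbTE gi) mul0r mulr0.
rewrite (bigD1 z) //= pe0 eqxx mulr1 big1 ?addr0 => [|g gz].
  by rewrite pdmiE (_ : mseq z = [::]) //; apply: size0nil; rewrite size_mseq /mdeg big1 // => i _; rewrite ffunE.
by rewrite pe0 (negbTE gz) mulr0.
Qed.

(** The matrix entries [K] of the push-forward are sums of polynomials in the base point times
    derivatives of order at most [p], hence continuous. Continuity is joint in the point and the
    form. *)
Lemma pushD_continuous c (zeta : Pdual m p) (e : R) : V c -> 0 < e ->
  exists2 dl : R, 0 < dl & forall a z, `|a - c| < dl -> dual_norm (z - zeta) < dl ->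
    dual_norm (pushD phi a z - pushD phi c zeta) < e.
Proof.
move=> Vc e0.
pose K (x : mi n p * mi m p) a := pullP phi a (monoP x.1) x.2.
have pushE a z al : pushD phi a z al = \sum_g z g * K (al, g) a by rewrite ffunE.
have K0 x : Cp 0 V (K x).
  rewrite (_ : K x = fun a => \sum_be
     pdmi be (fun y => peval (monoP x.1) (phi y)) a * shiftP a be x.2); last first.
    by apply/funext => a; rewrite /K /pullP /taylorP sum_ffunE; apply: eq_bigr => be _; rewrite ffunE.
  apply: Cp_sum => // be; apply: CpM => //.
    by rewrite pdmiE; apply: (Cp_Dseq (Cp_mono_comp _)); rewrite addn0 size_mseq_le.
  rewrite (_ : (fun a => _) = fun a : 'rV[R]_m => (mfact be)%:R^-1 * \prod_i
     ('C(val be i, val x.2 i)%:R * (-1 * a ord0 i) ^+ (val be i - val x.2 i)%N)); last first.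
    by apply/funext => a; rewrite shiftPE; congr (_ * _); apply: eq_bigr => i _; rewrite mulN1r.
  apply: CpZ => //; apply: Cp_prod => // i; apply: CpZ => //; apply: CpX => //.
  by apply: CpZ => //; exact: Cp_coord.
(* Each coordinate of the error is at most [dual_norm (z - zeta) * B + dual_norm zeta * e1]. The
   choices of [e1] and [d2] make both terms at most [e / (2 * N)], and [N] exceeds the number of
   coordinates. *)
pose N : R := #|{: mi n p}|%:R + 1; have N0 : 0 < N by rewrite ltr_wpDl.
pose S := dual_norm zeta + 1; have S0 : 0 < S by rewrite ltr_wpDl ?dual_norm_ge0.
pose e1 := e / (2 * N * S); have e10 : 0 < e1 by rewrite divr_gt0 // !mulr_gt0.
have [d1 d10 H1] : exists2 dl : R, 0 < dl &
    forall a, `|a - c| < dl -> forall x, `|K x a - K x c| < e1.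
  apply: ball_forall => x; apply: (proj1 (continuous_rowP _ _)) => //.
  exact: Cp_continuous (K0 x) _ Vc.
pose B := \sum_x `|K x c| + e1 + 1.
have B0 : 0 < B by rewrite ltr_wpDl // addr_ge0 ?(ltW e10) // sumr_ge0.
have KB a x : `|a - c| < d1 -> `|K x a| <= B.
  move=> /H1/(_ x) h; rewrite -[K x a](subrK (K x c)).
  apply: le_trans (ler_normD _ _) _.
  have : `|K x c| <= \sum_x `|K x c| by rewrite (bigD1 x) //= lerDl sumr_ge0.
  by move: h; rewrite /B; move: (\sum_x _) => T h1 h2; lra.
pose d2 := e / (2 * N * B); have d20 : 0 < d2 by rewrite divr_gt0 // !mulr_gt0.
exists (Num.min d1 d2); first by rewrite lt_min d10.
move=> a z; rewrite !lt_min => /andP[ac _] /andP[_ zz].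
have bnd al : `|(pushD phi a z - pushD phi c zeta) al| <= e / N.
  rewrite !ffunE -/(pushD phi a z al).
  have -> : dapp z (pullP phi a (monoP al)) - dapp zeta (pullP phi c (monoP al)) =
     \sum_g ((z - zeta) g * K (al, g) a) + \sum_g (zeta g * (K (al, g) a - K (al, g) c)).
    rewrite -big_split /dapp -sumrB; apply: eq_bigr => g _ /=.
    by rewrite !ffunE /K /=; ring.
  apply: le_trans (ler_normD _ _) _.
  have -> : e / N = d2 * B + S * e1.
    by rewrite /d2 /e1; field; rewrite !gt_eqF.
  apply: lerD.
    apply: (@le_trans _ _ (dual_norm (z - zeta) * B)); last by rewrite ler_wpM2r ?ltW.
    apply: le_trans (ler_norm_sum _ _ _) _; rewrite /dual_norm mulr_suml.
    by apply: ler_sum => g _; rewrite normrM ler_wpM2l // KB.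
  apply: (@le_trans _ _ (dual_norm zeta * e1)); last first.
    by rewrite ler_wpM2r ?(ltW e10) // /S lerDl.
  apply: le_trans (ler_norm_sum _ _ _) _; rewrite /dual_norm mulr_suml.
  by apply: ler_sum => g _; rewrite normrM ler_wpM2l // ltW // H1.
apply: le_lt_trans (ler_sum _ (fun al _ => bnd al)) _.
rewrite sumr_const -[ltLHS]mulr_natr mulrAC ltr_pdivrMr // ltr_pM2l //.
by rewrite /N ltrDl.
Qed.

Lemma taylorPB h1 h2 (b : 'rV[R]_m) : V b -> Cp p V h1 -> Cp p V h2 ->
  taylorP p (fun x => h1 x - h2 x) b = taylorP p h1 b - taylorP p h2 b.
Proof.
move=> Vb C1 C2; rewrite /taylorP -sumrB; apply: eq_bigr => be _.
by rewrite -scalerBl !pdmiE (DseqB oV C1 C2) ?inE // size_mseq_le.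
Qed.

Lemma pushD_diff c (e : R) : V c -> 0 < e ->
  exists2 dl : R, 0 < dl & forall a b (eta : Pdual m p), `|a - c| < dl -> `|b - c| < dl ->
    (forall g : mi m p, eucl_norm (a - b) ^+ (p - mdeg g) * `|zcomp eta b g| <= 1) ->
    dual_norm (pushD phi b eta - pushD phi a eta) < e.
Proof.
move=> Vc e0.
pose h (al : mi n p) y := peval (monoP al) (phi y).
pose N : R := (#|{: mi n p}| * #|{: mi m p}|)%:R + 1; have N0 : 0 < N by rewrite ltr_wpDl.
pose e1 := e / N; have e10 : 0 < e1 by rewrite divr_gt0.
have /fin_all_exists2[dl dl0 Hdl] : forall al, exists2 dl : R, 0 < dl &
    forall a b, `|a - c| < dl -> `|b - c| < dl -> forall be : mi m p,
    `|pdmi be (fun x => h al x - peval (taylorP p (h al) a) x) b| <= e1 * `|b - a| ^+ (p - mdeg be).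
  by move=> al; exact: taylor_remainder oV (Cp_mono_comp al) Vc e10.
have /nbhs_rowP[d2 d20 H2] := open_nbhs_nbhs (conj oV Vc).
exists (Num.min d2 (\big[Num.min/1]_al dl al)).
  by rewrite lt_min d20 /=; elim/big_ind: _ => // x y x0 y0; rewrite lt_min x0.
move=> a b eta; rewrite !lt_min => /andP[a2 a1] /andP[b2 b1] Heta.
have bnd al : `|(pushD phi b eta - pushD phi a eta) al| <= e1 * #|{: mi m p}|%:R.
  have al1 x : `|x - c| < \big[Num.min/1]_al dl al -> `|x - c| < dl al.
    by move=> xc; apply: lt_le_trans xc _; rewrite (bigD1 al) //= ge_min lexx.
  rewrite !ffunE -dappB.
  (* T_a h has degree at most p, so it is its own Taylor polynomial at b. Hence T_b h - T_a h = T_b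
     (h - T_a h), whose coefficients are the derivatives bounded by [taylor_remainder]. *)
  have -> : pullP phi b (monoP al) - pullP phi a (monoP al) =
      taylorP p (fun x => h al x - peval (taylorP p (h al) a) x) b.
    rewrite taylorPB //; [|exact: H2|exact: Cp_mono_comp|exact: Cp_peval].
    by rewrite taylorP_peval.
  rewrite dapp_taylorP; apply: le_trans (ler_norm_sum _ _ _) _.
  rewrite mulr_natr -sumr_const; apply: ler_sum => be _.
  rewrite normrM; apply: le_trans (ler_wpM2r _ (Hdl al a b (al1 _ a1) (al1 _ b1) be)) _ => //.
  rewrite -mulrA -[leRHS]mulr1 ler_wpM2l ?(ltW e10) //.
  apply: le_trans (Heta be); rewrite ler_wpM2r // lerXn2r ?nnegrE ?sqrtr_ge0 //.
  by rewrite distrC norm_le_eucl.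
apply: le_lt_trans (ler_sum _ (fun al _ => bnd al)) _.
rewrite sumr_const -[ltLHS]mulr_natr -mulrA -natrM /e1 mulrAC ltr_pdivrMr // ltr_pM2l //.
by rewrite /N mulnC ltrDl.
Qed.

Lemma phi_lipschitz c : V c -> exists2 L : R, 1 <= L & exists2 dl : R, 0 < dl &
  forall a b, `|a - c| < dl -> `|b - c| < dl -> forall k, (k <= p)%N ->
    eucl_norm (phi a - phi b) ^+ k <= L * eucl_norm (a - b) ^+ k.
Proof.
move=> Vc; have [p0|p0] := posnP p.
  exists 1 => //; exists 1 => // a b _ _ k; rewrite p0 leqn0 => /eqP ->.
  by rewrite !expr0 mulr1.
have /nbhs_rowP[d2 d20 H2] := open_nbhs_nbhs (conj oV Vc).
pose F (x : 'I_n * 'I_m) := pd x.2 (fun y => phi y ord0 x.1).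
have [d1 d10 H1] : exists2 dl : R, 0 < dl &
    forall a, `|a - c| < dl -> forall x, `|F x a - F x c| < 1.
  apply: ball_forall => x; apply: (proj1 (continuous_rowP _ _)) => //.
  by have [+ _] := Cphi x.1 (s := [:: x.2]) p0; apply.
pose B := \sum_x `|F x c| + 1.
have B0 : 0 < B by rewrite ltr_wpDl // sumr_ge0.
have FB a x : `|a - c| < d1 -> `|F x a| <= B.
  move=> /H1/(_ x) h; rewrite -[F x a](subrK (F x c)).
  apply: le_trans (ler_normD _ _) _.
  have : `|F x c| <= \sum_x `|F x c| by rewrite (bigD1 x) //= lerDl sumr_ge0.
  by move: h; rewrite /B; move: (\sum_x _) => T h1 h2; lra.
pose L0 := 1 + n%:R * (m%:R * B).
have L01 : 1 <= L0 by rewrite lerDl !mulr_ge0 // ltW.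
exists (L0 ^+ p); first exact: exprn_ege1.
exists (Num.min d1 d2); first by rewrite lt_min d10.
move=> a b; rewrite !lt_min => /andP[a1 a2] /andP[b1 b2] k kp.
have lip : eucl_norm (phi a - phi b) <= L0 * eucl_norm (a - b).
  apply: le_trans (eucl_le_norm _) _.
  apply: (@le_trans _ _ (n%:R * (m%:R * B * `|a - b|))).
    rewrite ler_wpM2l //; apply: norm_row_le => [|i]; first by rewrite !mulr_ge0 // ltW.
    rewrite !mxE -mulrA; apply: (@coord_MVT R m (fun y => phi y ord0 i)) => j y bx.
    have yc1 := in_box_ball b1 a1 bx; have yc2 := in_box_ball b2 a2 bx; split.
      by have [_ +] := Cphi i (s := [::]) isT; apply => //; exact: H2.
    exact: (FB y (i, j)).
  rewrite mulrA; apply: ler_pM => //; rewrite ?norm_le_eucl // ?mulr_ge0 ?(ltW B0) //.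
  by rewrite /L0 lerDr.
apply: (@le_trans _ _ ((L0 * eucl_norm (a - b)) ^+ k)).
  by rewrite lerXn2r ?nnegrE ?sqrtr_ge0 // mulr_ge0 ?sqrtr_ge0 // (le_trans _ L01).
by rewrite exprMn ler_wpM2r ?exprn_ge0 ?sqrtr_ge0 // ler_weXn2l.
Qed.

Lemma pushD_bound c : V c -> exists2 C : R, 1 <= C & exists2 dl : R, 0 < dl &
  forall a b (eta : Pdual m p), `|a - c| < dl -> `|b - c| < dl ->
    (forall g : mi m p, eucl_norm (a - b) ^+ (p - mdeg g) * `|zcomp eta b g| <= 1) ->
    forall g : mi n p, eucl_norm (phi a - phi b) ^+ (p - mdeg g) *
      `|zcomp (pushD phi b eta) (phi b) g| <= C.
Proof.
move=> Vc; have [L L1 [d3 d30 H3]] := phi_lipschitz Vc.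
pose D (x : mi m p * mi n p) b := pdmi x.1 (fun y => peval (shiftP (phi b) x.2) (phi y)) b.
(* In [D] the point [b] is both the centre of the polynomial and the point of evaluation; the
   expansion in monomials separates the two roles and shows continuity. *)
have DE x b : V b -> D x b = \sum_al shiftP (phi b) x.2 al *
    pdmi x.1 (fun y => peval (monoP al) (phi y)) b.
  move=> Vb; rewrite /D (_ : (fun y => peval (shiftP (phi b) x.2) (phi y)) =
   fun y => \sum_al shiftP (phi b) x.2 al * peval (monoP al) (phi y)); last first.
    by apply/funext => y; rewrite {1}(Ppoly_mono (shiftP _ _)) peval_lin.
  by rewrite (pdmi_lin _ _ _ oV) // => al; exact: Cp_mono_comp.
have D0 x : {for c, continuous (D x)}.
  suff C0 : Cp 0 V (D x) by exact: Cp_continuous C0 _ Vc.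
  apply: (@Cp_eq_on _ _ 0 V (fun b => \sum_al shiftP (phi b) x.2 al *
    pdmi x.1 (fun y => peval (monoP al) (phi y)) b)) => //.
    by move=> b; rewrite inE => Vb; rewrite DE.
  apply: Cp_sum => // al; apply: CpM => //; last first.
    by rewrite pdmiE; apply: (Cp_Dseq (Cp_mono_comp _)); rewrite addn0 size_mseq_le.
  rewrite (_ : (fun a => _) = fun a : 'rV[R]_m => (mfact x.2)%:R^-1 * \prod_i
     ('C(val x.2 i, val al i)%:R * (-1 * phi a ord0 i) ^+ (val x.2 i - val al i)%N)); last first.
    by apply/funext => a; rewrite shiftPE; congr (_ * _); apply: eq_bigr => i _; rewrite mulN1r.
  apply: CpZ => //; apply: Cp_prod => // i; apply: CpZ => //; apply: CpX => //.
  by apply: CpZ => //; exact: Cp_leq (leq0n _) (Cphi i).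
have [d1 d10 H1] : exists2 dl : R, 0 < dl &
    forall a, `|a - c| < dl -> forall x, `|D x a - D x c| < 1.
  by apply: ball_forall => x; apply: (proj1 (continuous_rowP _ _)).
have /nbhs_rowP[d2 d20 H2] := open_nbhs_nbhs (conj oV Vc).
pose B := \sum_x `|D x c| + 1.
have B0 : 0 < B by rewrite ltr_wpDl // sumr_ge0.
have DB a x : `|a - c| < d1 -> `|D x a| <= B.
  move=> /H1/(_ x) h; rewrite -[D x a](subrK (D x c)).
  apply: le_trans (ler_normD _ _) _.
  have : `|D x c| <= \sum_x `|D x c| by rewrite (bigD1 x) //= lerDl sumr_ge0.
  by move: h; rewrite /B; move: (\sum_x _) => T h1 h2; lra.
have Dvan (be : mi m p) (ga : mi n p) b : V b -> (mdeg be < mdeg ga)%N -> D (be, ga) b = 0.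
  move=> Vb bega; rewrite /D /=.
  rewrite (_ : (fun y => _) = fun y => (mfact ga)%:R^-1 * mpow (phi b) (fun i => val ga i) (phi y)); last first.
    by apply/funext => y; exact: peval_shiftP.
  have Ci i : Cp p V (fun y => phi y ord0 i - phi b ord0 i).
    by apply: CpB => //; exact: Cp_cst.
  rewrite pdmiE (DseqZ (p := p) _ oV) ?inE ?size_mseq_le //; last first.
    by apply: Cp_prod => // i; apply: CpX.
  rewrite (@flat_prod R m p V _ _ (fun i y => (phi y ord0 i - phi b ord0 i) ^+ val ga i)
     (fun i => val ga i) b) ?mulr0 ?size_mseq_le ?size_mseq //.
    by move=> i; apply: CpX.
  by move=> i; apply: (flat_exp oV Vb) => //; rewrite subrr.
pose C := #|{: mi m p}|%:R * (L * B) + 1.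
have LB : 0 <= L * B by rewrite mulr_ge0 ?(ltW B0) // (le_trans _ L1).
exists C; first by rewrite /C lerDr mulr_ge0.
(* This radius forces [eucl_norm (a - b) <= 1], so that its powers decrease with the exponent. *)
pose d4 : R := (2 * (m%:R + 1))^-1; have d40 : 0 < d4 by rewrite invr_gt0 mulr_gt0 // ltr_wpDl.
exists (Num.min (Num.min d1 d2) (Num.min d3 d4)); first by rewrite !lt_min d10 d20 d30.
move=> a b eta; rewrite !lt_min => /andP[/andP[a1 a2] /andP[a3 a4]] /andP[/andP[b1 b2] /andP[b3 b4]].
move=> Heta ga; have Vb := H2 _ b2.
have ab1 : eucl_norm (a - b) <= 1.
  apply: le_trans (eucl_le_norm _) _.
  have : `|a - b| <= 2 * d4.
    have -> : a - b = (a - c) - (b - c) by rewrite opprB addrA subrK.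
    by apply: le_trans (ler_normB _ _) _; lra.
  move=> abd; apply: (@le_trans _ _ (m%:R * (2 * d4))); first by rewrite ler_wpM2l.
  have -> : 2 * d4 = (m%:R + 1)^-1 by rewrite /d4 invfM mulVKf // pnatr_eq0.
  rewrite ler_pdivrMr ?ltr_wpDl // mul1r.
  by rewrite lerDl.
have -> : zcomp (pushD phi b eta) (phi b) ga = \sum_be D (be, ga) b * zcomp eta b be.
  by rewrite /zcomp dapp_pushD // dapp_taylorP.
apply: (@le_trans _ _ (\sum_(be : mi m p) L * B)); last first.
  by rewrite sumr_const -[leLHS]mulr_natl /C lerDl.
rewrite -{1}[eucl_norm (phi a - phi b)]ger0_norm ?sqrtr_ge0 // -normrX -normrM mulr_sumr.
apply: le_trans (ler_norm_sum _ _ _) _; apply: ler_sum => be _.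
have [lt|le] := ltnP (mdeg be) (mdeg ga); first by rewrite Dvan // mul0r mulr0 normr0.
rewrite !normrM normrX (ger0_norm (sqrtr_ge0 _)).
apply: (@le_trans _ _ ((L * eucl_norm (a - b) ^+ (p - mdeg ga)) * (B * `|zcomp eta b be|))).
  apply: ler_pM; rewrite ?exprn_ge0 ?sqrtr_ge0 ?mulr_ge0 //.
    by apply: H3 => //; rewrite leq_subr.
  by rewrite ler_wpM2r // DB.
have -> : L * eucl_norm (a - b) ^+ (p - mdeg ga) * (B * `|zcomp eta b be|) =
  L * B * (eucl_norm (a - b) ^+ (p - mdeg ga) * `|zcomp eta b be|) by ring.
(* Here [mdeg ga <= mdeg be], so passing to the exponent [p - mdeg be] can only increase the power
   of a distance at most 1; then the constraint on [eta] applies. *)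
rewrite -[leRHS]mulr1 ler_wpM2l //; apply: le_trans (Heta be).
rewrite ler_wpM2r //; apply: ler_wiXn2l; rewrite ?sqrtr_ge0 //.
by rewrite leq_sub2l.
Qed.

End Pushforward.

(** * Stabilization of increasing bundles *)


Section Stabilization.
Context {R : realType}.

(** Bolzano-Weierstrass for a condition [P e] that tightens as [e] shrinks: one bounded vector is
    chosen at each scale 1/(i+1), and [v] is a cluster point of the sequence. *)
Lemma cluster_rV N (P : R -> 'rV[R]_N -> Prop) (M : R) :
  (forall e e' v, e' <= e -> P e' v -> P e v) ->
  (forall e, 0 < e -> exists2 v, P e v & `|v| <= M) ->
  exists v, forall e, 0 < e -> exists2 w, P e w & `|w - v| < e.
Proof.
move=> Pmono PM.
have e_gt0 (i : nat) : 0 < (i.+1%:R : R)^-1 by rewrite invr_gt0.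
have /choice[u Hu] : forall i : nat, exists v, P i.+1%:R^-1 v /\ `|v| <= M.
  by move=> i; have [v] := PM _ (e_gt0 i); exists v.
pose K := [set v : 'rV[R]_N | forall i, `[- M, M]%classic (v ord0 i)].
have cK : compact K by apply: (@rV_compact R N (fun=> `[- M, M]%classic)) => i; exact: segment_compact.
have uK : (u @ \oo) K.
  exists 0%N => // i _ j /=; rewrite in_itv /= -ler_norml.
  exact: le_trans (norm_coord_le _ _) (Hu i).2.
have [v [_ cv]] := cK (u @ \oo) _ uK; exists v => e e0.
have eV0 : 0 < e^-1 by rewrite invr_gt0.
have F : (u @ \oo) [set w | P e w].
  exists (Num.bound e^-1) => // i /= i0i; apply: Pmono (Hu i).1.
  rewrite -[leRHS]invrK lef_pV2 ?posrE // ltW // (lt_le_trans (archi_boundP (ltW eV0))) //.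
  by rewrite ler_nat ltnW.
have B : nbhs v [set w | `|w - v| < e] by apply/nbhs_rowP; exists e.
by have [w [Pw wv]] := cv _ _ F B; exists w.
Qed.

(** Makes ranks and complements available for fibres given as predicates. [A] has maximal rank among
    the matrices with row space inside [S]; a vector of [S] outside it would raise the rank. *)
Lemma subspace_mx N (S : 'rV[R]_N -> Prop) : S 0 ->
  (forall (c : R) u v, S u -> S v -> S (c *: u + v)) ->
  exists A : 'M[R]_N, forall v, S v <-> (v <= A)%MS.
Proof.
move=> S0 Slin.
pose P := [pred r | `[< exists2 A : 'M[R]_N, (forall v : 'rV_N, (v <= A)%MS -> S v) & \rank A = r >]].
have exP : exists r, P r.
  exists 0%N; apply/asboolP; exists 0; last by rewrite mxrank0.
  by move=> v; rewrite submx0 => /eqP ->.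
have leP r : P r -> (r <= N)%N by move=> /asboolP[A _ <-]; exact: rank_leq_row.
case: (ex_maxnP exP leP) => r /asboolP[A AS rA] rmax.
exists A => v; split; last exact: AS.
move=> Sv; apply/negPn/negP => vA.
have AvS w : (w <= A + v)%MS -> S w.
  move=> /sub_addsmxP[[u1 u2] /= ->]; rewrite addrC.
  have /sub_rVP[c ->] : (u2 *m v <= v)%MS by rewrite submxMl.
  by apply: Slin => //; apply: AS; rewrite submxMl.
have /rmax : P (\rank (A + v)%MS) by apply/asboolP; exists (A + v)%MS.
rewrite -rA leqNgt => /negP; apply.
have : (A < A + v)%MS.
  rewrite ltmxE addsmxSl /=; apply: contra vA; apply: submx_trans; exact: addsmxSr.
by rewrite ltmxErank => /andP[].
Qed.

(** The properties of Glaeser's iteration that the rank argument rests on. Beyond linearity and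
    growth they are: one step adds all limits of nearby fibres, and a step that changes nothing near
    a point is followed by one that changes nothing there. *)
Context {d N : nat} (Z : set 'rV[R]_d) (E : nat -> 'rV[R]_d -> 'rV[R]_N -> Prop).
Hypothesis E_zero : forall k x, Z x -> E k x 0.
Hypothesis E_lin : forall k x, Z x -> forall (c : R) u v,
  E k x u -> E k x v -> E k x (c *: u + v).
Hypothesis E_nonzero : forall x, Z x -> exists2 v, E 0 x v & v != 0.
Hypothesis E_incr : forall k x v, Z x -> E k x v -> E k.+1 x v.
Hypothesis E_closure : forall k x v, Z x ->
  (forall e : R, 0 < e -> exists y w, [/\ Z y, `|y - x| < e, `|w - v| < e & E k y w]) ->
  E k.+1 x v.
Hypothesis E_local : forall k x, Z x ->
  (exists2 e : R, 0 < e & forall y v, Z y -> `|y - x| < e -> E k.+1 y v -> E k y v) ->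
  forall v, E k.+2 x v -> E k.+1 x v.

Let E_mx k x : {A : 'M[R]_N | Z x -> forall v, E k x v <-> (v <= A)%MS}.
Proof.
apply: cid; have [Zx|nZ] := pselect (Z x); last by exists 0.
have [A HA] := subspace_mx (E_zero k Zx) (E_lin Zx).
by exists A.
Qed.

Let M k x := sval (E_mx k x).
Let ME k x v : Z x -> E k x v <-> (v <= M k x)%MS.
Proof. by move=> Zx; exact: (svalP (E_mx k x) Zx). Qed.

Let E_incr_leq k l x v : Z x -> (k <= l)%N -> E k x v -> E l x v.
Proof.
move=> Zx /subnK <-; elim: (l - k)%N => [|i IH] // /IH.
by rewrite addSn; exact: E_incr.
Qed.

Let M_incr k l x : Z x -> (k <= l)%N -> (M k x <= M l x)%MS.
Proof.
move=> Zx kl; apply/rV_subP => v; rewrite -!ME //; exact: E_incr_leq.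
Qed.

(* A nonzero vector of E k y in a fixed complement of E k.+1 x, normalized,
   would accumulate at a nonzero vector of E k.+1 x in that complement. *)
Lemma rank_semicontinuous k x : Z x -> exists2 e : R, 0 < e &
  forall y, Z y -> `|y - x| < e -> (\rank (M k y) <= \rank (M k.+1 x))%N.
Proof.
move=> Zx; apply: contrapT => H.
pose C := ((M k.+1 x)^C)%MS.
pose P (e : R) (w : 'rV[R]_N) :=
  exists y, [/\ Z y, `|y - x| < e, E k y w, (w <= C)%MS & `|w| = 1].
have [e e' v ee' [y [Zy yx Ey wC w1]]|e e0|v Hv] := @cluster_rV N P 1.
- by exists y; split => //; exact: lt_le_trans ee'.
- have [y [Zy yx rk]] : exists y, [/\ Z y, `|y - x| < e & (\rank (M k.+1 x) < \rank (M k y))%N].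
    apply: contrapT => H'; apply: H; exists e => // y Zy yx.
    by rewrite leqNgt; apply/negP => lt; apply: H'; exists y.
  have : (M k y :&: C)%MS != 0.
    (* Dimension count: the ranks of [M k y] and of the complement [C] add up to more than [N]. *)
    rewrite -mxrank_eq0 -lt0n.
    have := mxrank_sum_cap (M k y) C; have := rank_leq_row (M k y + C)%MS.
    have := mxrank_compl (M k.+1 x); rewrite -/C; have := rank_leq_row (M k.+1 x).
    move: (\rank C) (\rank (M k y)) (\rank (M k.+1 x)) (\rank _) (\rank _) rk.
    move=> r1 r2 r3 r4 r5; clear; lia.
  move=> /rowV0Pn[w wcap wn0]; have w0 : `|w| != 0 by rewrite normr_eq0.
  have w'1 : `| `|w|^-1 *: w| = 1 by rewrite normrZ normrV ?unitfE // normr_id mulVf.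
  exists (`|w|^-1 *: w); last by rewrite w'1.
  exists y; split => //.
    by apply/ME => //; apply: scalemx_sub; apply: submx_trans wcap _; exact: capmxSl.
  by apply: scalemx_sub; apply: submx_trans wcap _; exact: capmxSr.
- have vE : E k.+1 x v.
    apply: E_closure => // e /Hv[w [y [Zy yx Ey _ _]] wv].
    by exists y, w.
  have vC : (v <= C)%MS.
    (* Row spaces are closed: [C] is the kernel of multiplication by [cokermx C], which is
       continuous. *)
    rewrite submxE; apply/eqP/rowP => j; rewrite [RHS]mxE.
    pose S : R := \sum_i `|cokermx C i j| + 1.
    have S0 : 0 < S by rewrite ltr_wpDl // sumr_ge0.
    apply/normr0_eq0/le_anti; rewrite normr_ge0 andbT; apply/ler_addgt0Pl => e e0.
    rewrite addr0; have [|w [y [_ _ _ wC _]] wv] := Hv (e / S); first exact: divr_gt0.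
    have -> : (v *m cokermx C) ord0 j = ((v - w) *m cokermx C) ord0 j.
      rewrite mulmxBl; move: wC; rewrite submxE => /eqP ->.
      by rewrite subr0.
    rewrite mxE; apply: le_trans (ler_norm_sum _ _ _) _.
    apply: (@le_trans _ _ (\sum_i `|v - w| * `|cokermx C i j|)).
      by apply: ler_sum => i _; rewrite normrM ler_wpM2r // norm_coord_le.
    rewrite -mulr_sumr; apply: (@le_trans _ _ ((e / S) * S)); last by rewrite divfK // gt_eqF.
    by apply: ler_pM; rewrite ?sumr_ge0 // ?lerDl // distrC ltW.
  have v1 : v != 0.
    apply/eqP => v0; have [w [y [_ _ _ _ w1]]] := Hv 1 ltr01.
    by rewrite v0 subr0 w1 ltxx.
  have : (v <= M k.+1 x :&: C)%MS by rewrite sub_capmx vC andbT; apply/ME.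
  by rewrite capmx_compl submx0 (negbTE v1).
Qed.

(** [E_local] is applied at every point [y] of the open ball, with the radius [e - |y - x|] that
    keeps its neighbourhood inside. *)
Lemma stable_on_ball j x (e : R) :
  (forall y v, Z y -> `|y - x| < e -> E j.+1 y v -> E j y v) ->
  forall l y v, (j <= l)%N -> Z y -> `|y - x| < e -> E l y v -> E j y v.
Proof.
move=> H l y v /subnK <-.
have step i : forall y v, Z y -> `|y - x| < e -> E (i + j).+1 y v -> E (i + j) y v.
  elim: i => [|i IH] {}y {}v Zy yx; first exact: H.
  rewrite addSn; apply: E_local => //; exists (e - `|y - x|); first by rewrite subr_gt0.
  move=> z w Zz zy; apply: IH => //.
  rewrite -[z](subrK y) -addrA; apply: le_lt_trans (ler_normD _ _) _; lra.
by elim: (l - j)%N => [|i IH] // Zy yx Ei; apply: IH => //; exact: step.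
Qed.

(** Origin of the factor 2: a rank bound at [x] for one index controls nearby ranks only at the
    index before, and that one is compared with its own predecessor, so each dimension costs two
    iterations. The base case is void, as fibres are nonzero. *)
Lemma stabilization_rank k x : Z x -> (\rank (M (2 * k) x) <= k)%N ->
  forall l v, (2 * k <= l)%N -> E l x v -> E (2 * k) x v.
Proof.
elim: k x => [|k IH] x Zx.
  rewrite muln0 leqn0 mxrank_eq0 => /eqP M0.
  have [v Ev v0] := E_nonzero Zx; move: Ev; rewrite ME // M0 submx0.
  by rewrite (negbTE v0).
have e2 : (2 * k.+1 = (2 * k).+2)%N by rewrite mulnS.
rewrite e2 => rk l v l2 Elv.
have [rk0|rk0] := leqP (\rank (M (2 * k) x)) k.
  have := IH x Zx rk0 l v; rewrite (ltnW (ltnW l2)) => /(_ isT Elv).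
  by apply: E_incr_leq => //; lia.
have [e e0 He] := rank_semicontinuous (2 * k).+1 Zx.
(* Either the rank at [y] is at most [k] and induction applies at [y], or it is at least k + 1 at
   index 2k and at most k + 1 at the next, so the two fibres coincide. *)
have st y w : Z y -> `|y - x| < e -> E (2 * k).+1 y w -> E (2 * k) y w.
  move=> Zy yx Ew; have [rky|rky] := leqP (\rank (M (2 * k) y)) k.
    by apply: (IH y Zy rky (2 * k).+1).
  have le := M_incr Zy (leqnSn (2 * k)).
  have eqr : \rank (M (2 * k) y) = \rank (M (2 * k).+1 y).
    apply/eqP; rewrite eqn_leq mxrankS //=.
    exact: leq_trans (He y Zy yx) (leq_trans rk rky).
  have /eqmxP/eqmx_sym ee : (M (2 * k) y == M (2 * k).+1 y)%MS.
    by rewrite -(mxrank_leqif_eq le) eqr.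
  by apply/ME => //; rewrite -ee; apply/ME.
have xx : `|x - x| < e by rewrite subrr normr0.
have l2' : (2 * k <= l)%N := ltnW (ltnW l2).
apply: (@E_incr_leq (2 * k)) => //; first by rewrite ltnW.
exact: (stable_on_ball st l2').
Qed.

Lemma stabilization l x v : Z x -> (2 * N <= l)%N -> E l x v -> E (2 * N) x v.
Proof. by move=> Zx; apply: stabilization_rank => //; exact: rank_leq_row. Qed.

End Stabilization.

(** * Glaeser iterates *)


Section Bundles.
Context {R : realType} {d p : nat} (Z : set 'rV[R]_d).
Implicit Types (Phi : @bundleR R d p) (h : 'rV[R]_d -> R).

Definition linear_bundle Phi :=
  [/\ forall a xi l, Phi a xi l -> Z a, forall a, Z a -> Phi a 0 0 &
      forall a (c : R) xi1 l1 xi2 l2, Phi a xi1 l1 -> Phi a xi2 l2 ->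
        Phi a (c *: xi1 + xi2) (c * l1 + l2)].

Lemma linear_bundleZ Phi a (c : R) xi l : linear_bundle Phi -> Phi a xi l ->
  Phi a (c *: xi) (c * l).
Proof.
move=> [PZ P0 Plin] H; rewrite -[c *: xi]addr0 -[c * l]addr0; apply: Plin => //.
exact/P0/PZ/H.
Qed.

Lemma linear_Phi0 h : linear_bundle (Phi0 Z h).
Proof.
split=> [a xi l []//|a Za|a c _ _ _ _ [Za [l1 [-> ->]]] [_ [l2 [-> ->]]]].
  by split => //; exists 0; rewrite scale0r mul0r.
split => //; exists (c * l1 + l2).
by rewrite scalerDl scalerA mulrDl mulrA.
Qed.

Lemma linear_rhoR Phi : linear_bundle (rhoR Z Phi).
Proof.
split=> [a xi l []//|a Za|].
  split => //; exists 0%N, (fun=> 0), (fun=> 0), (fun=> 0).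
  by split; [case|rewrite !big_ord0].
move=> a c _ _ _ _ [Za [k1 [c1 [v1 [w1 [H1 [-> ->]]]]]]] [_ [k2 [c2 [v2 [w2 [H2 [-> ->]]]]]]].
split => //; exists (k1 + k2)%N.
exists (fun i => match fintype.split i with inl j => c * c1 j | inr j => c2 j end).
exists (fun i => match fintype.split i with inl j => v1 j | inr j => v2 j end).
exists (fun i => match fintype.split i with inl j => w1 j | inr j => w2 j end).
split=> [i|]; first by case: fintype.split.
rewrite !big_split_ord /= scaler_sumr mulr_sumr.
by split; congr (_ + _); apply: eq_bigr => i _;
  rewrite ?(unsplitK (inl i)) ?(unsplitK (inr i)) ?scalerA ?mulrA.
Qed.

Lemma rhoR_prime Phi a (c : R) xi l : Phiprime Z Phi a xi l ->
  rhoR Z Phi a (c *: xi) (c * l).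
Proof.
move=> H; split; first by case: H.
exists 1%N, (fun=> c), (fun=> xi), (fun=> l).
by split => //; rewrite !big_ord1.
Qed.

Lemma rhoR_prime1 Phi a xi l : Phiprime Z Phi a xi l -> rhoR Z Phi a xi l.
Proof. by move=> /(rhoR_prime 1); rewrite scale1r mul1r. Qed.

Lemma zcomp0 (b : 'rV[R]_d) (g : mi d p) : zcomp 0 b g = 0.
Proof. by have := zcompZ 0 (0 : Pdual d p) b g; rewrite scale0r mul0r. Qed.

(** Diagonal pairs (y, y) with second summand 0 satisfy the constraint trivially, so Phi' contains
    the closure of the bundle. *)
Lemma Phiprime_closure Phi a xi l : linear_bundle Phi -> Z a ->
  (forall e : R, 0 < e -> exists y zeta mu, [/\ Phi y zeta mu, eucl_norm (y - a) < e,
     dual_norm (zeta - xi) < e & `|mu - l| < e]) ->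
  Phiprime Z Phi a xi l.
Proof.
move=> [PZ P0 _] Za H; split => // e /H[y [zeta [mu [Py ya zx ml]]]].
have Zy := PZ _ _ _ Py.
exists y, y, zeta, mu; split => //; split => //; split => //.
exists zeta, mu, 0, 0; rewrite !addr0; split => //; split; first exact: P0.
do 2 split => //; move=> g; by rewrite zcomp0 normr0 mulr0.
Qed.

Lemma eucl_norm0 : eucl_norm (0 : 'rV[R]_d) = 0.
Proof. by rewrite /eucl_norm big1 ?sqrtr0 // => i _; rewrite mxE expr0n. Qed.

Lemma dual_norm0 : dual_norm (0 : @Pdual R d p) = 0.
Proof. by rewrite /dual_norm big1 // => i _; rewrite ffunE normr0. Qed.

Lemma rhoR_incr Phi a xi l : linear_bundle Phi -> Phi a xi l -> rhoR Z Phi a xi l.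
Proof.
move=> lin Pa; apply/rhoR_prime1/Phiprime_closure => //.
  by case: lin => PZ _ _; exact: PZ Pa.
by move=> e e0; exists a, xi, l; rewrite !subrr eucl_norm0 dual_norm0 normr0.
Qed.

Lemma rhoR_local Phi1 Phi2 a xi l (e : R) : 0 < e ->
  (forall y zeta mu, Z y -> `|y - a| < e -> Phi1 y zeta mu -> Phi2 y zeta mu) ->
  rhoR Z Phi1 a xi l -> rhoR Z Phi2 a xi l.
Proof.
move=> e0 H [Za [k [c [v [w [Hv E]]]]]]; split => //.
exists k, c, v, w; split => // i; have [_ Hi] := Hv i; split => // e1 e10.
have [|a1 [b1 [z [nu [[Za1 [Zb1 [x1 [l1 [x2 [l2 [P1 [P2 [E1 [E2 B]]]]]]]]]] [A1 [B1 [C1 D1]]]]]]]] := Hi (Num.min e e1).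
  by rewrite lt_min e0.
move: A1 B1 C1 D1; rewrite !lt_min => /andP[A1 A2] /andP[B1 B2] /andP[_ C1] /andP[_ D1].
exists a1, b1, z, nu; split => //; split => //; split => //.
exists x1, l1, x2, l2; split; first by apply: H => //; exact: le_lt_trans (norm_le_eucl _) A1.
by split => //; apply: H => //; exact: le_lt_trans (norm_le_eucl _) B1.
Qed.

Section Iterates.
Variable h : 'rV[R]_d -> R.
Let Ph k := iter k (rhoR Z) (@Phi0 R d p Z h).

Lemma linear_iter k : linear_bundle (Ph k).
Proof. by case: k => [|k]; [exact: linear_Phi0|exact: linear_rhoR]. Qed.

Lemma iter_incr k l a xi lam : (k <= l)%N -> Ph k a xi lam -> Ph l a xi lam.
Proof.
move=> /subnK <-; elim: (l - k)%N => [|i IH] // /IH.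
by rewrite addSn; apply: rhoR_incr; exact: linear_iter.
Qed.

Lemma deltaP_neq0 (x : 'rV[R]_d) : deltaP p x != 0.
Proof.
have z0 : (\sum_(i < d) (([ffun=> ord0] : {ffun 'I_d -> 'I_p.+1}) i : nat) <= p)%N.
  by rewrite big1 // => i _; rewrite ffunE.
pose z : mi d p := exist (fun g : {ffun 'I_d -> 'I_p.+1} => (\sum_i (g i : nat) <= p)%N) _ z0.
apply/eqP => /ffunP/(_ z)/eqP; rewrite !ffunE /mono big1 ?oner_eq0 // => i _.
by rewrite ffunE expr0.
Qed.

(** Carries [stabilization] over to the iterates through a bounded linear decoding of R^N. Only
    pairs that actually occur need a preimage, so the same lemma serves with and without values. *)
Lemma iter_stabilization N (dec1 : 'rV[R]_N -> @Pdual R d p) (dec2 : 'rV[R]_N -> R) (C : R) :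
  (forall c u v, dec1 (c *: u + v) = c *: dec1 u + dec1 v) ->
  (forall c u v, dec2 (c *: u + v) = c * dec2 u + dec2 v) ->
  (forall v, dual_norm (dec1 v) <= C * `|v|) -> (forall v, `|dec2 v| <= C * `|v|) ->
  (forall k a xi lam, Ph k a xi lam -> exists2 v, dec1 v = xi & dec2 v = lam) ->
  forall l a xi lam, Ph l a xi lam -> Ph (2 * N) a xi lam.
Proof.
move=> lin1 lin2 C1 C2 surj l a xi lam Pl.
have d10 : dec1 0 = 0 by have := lin1 (-1) 0 0; rewrite scaler0 addr0 scaleN1r addNr.
have d20 : dec2 0 = 0 by have := lin2 (-1) 0 0; rewrite scaler0 addr0 mulN1r addNr.
have sub1 u v : dec1 (u - v) = dec1 u - dec1 v.
  by rewrite addrC -scaleN1r lin1 scaleN1r addrC.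
have sub2 u v : dec2 (u - v) = dec2 u - dec2 v.
  by rewrite addrC -scaleN1r lin2 mulN1r addrC.
have [lN|lN] := leqP l (2 * N); first exact: iter_incr Pl.
have Za : Z a by have [PZ _ _] := linear_iter l; exact: PZ Pl.
have [v v1 v2] := surj _ _ _ _ Pl.
rewrite -v1 -v2 in Pl *.
apply: (@stabilization R d N Z (fun k x v => Ph k x (dec1 v) (dec2 v))) (ltnW lN) Pl => //.
- by move=> k x Zx; rewrite d10 d20; have [_ + _] := linear_iter k; apply.
- by move=> k x Zx c u w Hu Hw; rewrite lin1 lin2; have [_ _] := linear_iter k; apply.
- move=> x Zx; have P0 : Ph 0 x (deltaP p x) (h x).
    by split => //; exists 1; rewrite scale1r mul1r.
  have [u u1 u2] := surj _ _ _ _ P0; exists u; first by rewrite u1 u2.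
  by apply/eqP => u0; have := deltaP_neq0 x; rewrite -u1 u0 d10 eqxx.
- by move=> k x w Zx; exact: iter_incr.
- move=> k x w Zx H; apply/rhoR_prime1/Phiprime_closure => //; first exact: linear_iter.
  (* [K] dominates both the ratio of the norms on the base and the bound [C] of the decoding. *)
  move=> e e0; pose K := d%:R + `|C| + 1; have K0 : 0 < K by rewrite ltr_wpDl ?addr_ge0.
  have [|y [u [Zy yx uw Pu]]] := H (e / K); first exact: divr_gt0.
  have small (t q : R) : 0 <= q -> t < e / K -> 0 <= t -> q <= K -> q * t < e.
    move=> q0 te t0 qK; have := te; rewrite ltr_pdivlMr //; apply: le_lt_trans.
    by rewrite mulrC ler_wpM2l.
  have dK : d%:R <= K by rewrite /K -addrA lerDl addr_ge0.
  have CK : `|C| <= K by rewrite /K [_ + `|C|]addrC -addrA lerDl addr_ge0.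
  have CC (t : R) : 0 <= t -> C * t <= `|C| * t by move=> t0; rewrite ler_wpM2r // ler_norm.
  exists y, (dec1 u), (dec2 u); split => //.
  + by apply: le_lt_trans (eucl_le_norm _) _; exact: small.
  + rewrite -sub1; apply: le_lt_trans (C1 _) _; apply: le_lt_trans (CC _ _) _ => //.
    exact: small.
  + rewrite -sub2; apply: le_lt_trans (C2 _) _; apply: le_lt_trans (CC _ _) _ => //.
    exact: small.
- move=> k x Zx [e e0 H] w; apply: (@rhoR_local (Ph k.+1) (Ph k) x _ _ e e0) => y zeta mu Zy yx Py.
  have [u u1 u2] := surj k.+1 _ _ _ Py; rewrite -u1 -u2 in Py *; exact: H.
Qed.

Lemma nablaP_stable l a xi lam : Ph l a xi lam -> nablaP Z h a xi lam.
Proof.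
pose N := (rdim d p).+1.
(* Coordinate 0 holds the value, the others the form. *)
pose dec1 (v : 'rV[R]_N) : Pdual d p := [ffun g => v ord0 (lift ord0 (enum_rank g))].
pose dec2 (v : 'rV[R]_N) : R := v ord0 ord0.
apply: (@iter_stabilization N dec1 dec2 N%:R).
- by move=> c u v; apply/ffunP => g; rewrite !ffunE !mxE.
- by move=> c u v; rewrite /dec2 !mxE.
- move=> v; apply: (@le_trans _ _ (\sum_(g : mi d p) `|v|)).
    by apply: ler_sum => g _; rewrite ffunE norm_coord_le.
  by rewrite sumr_const -[leLHS]mulr_natl ler_wpM2r // ler_nat /N /rdim.
- move=> v; apply: le_trans (norm_coord_le _ _) _.
  by rewrite ler_peMl // ler1n.
- move=> k b zeta mu _; exists (\row_i if unlift ord0 i is Some j then zeta (enum_val j) else mu).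
    by apply/ffunP => g; rewrite ffunE mxE liftK enum_rankK.
  by rewrite /dec2 mxE unlift_none.
Qed.

End Iterates.

(** With the zero function all values stay 0, even in the closure; results on bundles with values
    thus specialize to tau^p. *)
Lemma tau_iter k a xi lam : iter k (rhoR Z) (@Phi0 R d p Z (fun=> 0)) a xi lam <->
  iter k (rhoP Z) (@E0 R d p Z) a xi /\ lam = 0.
Proof.
elim: k a xi lam => [|k IH] a xi lam.
  split=> [[Za [l [-> ->]]]|[[Za [l ->]] ->]].
    by rewrite mulr0; split => //; split => //; exists l.
  by split => //; exists l; rewrite mulr0.
rewrite /= ; set Phi := iter k _ _ in IH *; set E := iter k _ _ in IH *.
have Delta a1 b1 z nu : DeltaPhi Z Phi a1 b1 z nu <-> DeltaE Z E a1 b1 z /\ nu = 0.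
  split=> [[Za [Zb [x1 [l1 [x2 [l2 [/IH[P1 ->] [/IH[P2 ->] [E1 [-> B]]]]]]]]]]|].
    by rewrite addr0; split => //; split => //; split => //; exists x1, x2.
  move=> [[Za [Zb [x1 [x2 [P1 [P2 [E1 B]]]]]]] ->]; split => //; split => //.
  exists x1, 0, x2, 0; rewrite addr0; split; first exact/IH.
  by split => //; exact/IH.
have prime b zeta mu : Phiprime Z Phi b zeta mu <-> Eprime Z E b zeta /\ mu = 0.
  split=> [[Zb H]|[[Zb H] ->]].
    split; last first.
      apply/normr0_eq0/le_anti; rewrite normr_ge0 andbT; apply/ler_addgt0Pl => e e0.
      rewrite addr0; have [a1 [b1 [z [nu [/Delta[_ ->] [_ [_ [_]]]]]]]] := H e e0.
      by rewrite sub0r normrN => /ltW.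
    split => // e e0; have [a1 [b1 [z [nu [/Delta[D _] [A [B [C _]]]]]]]] := H e e0.
    by exists a1, b1, z.
  split => // e e0; have [a1 [b1 [z [D [A [B C]]]]]] := H e e0.
  exists a1, b1, z, 0; split; first exact/Delta.
  by rewrite subrr normr0.
split=> [[Za [q [c [v [w [H [-> ->]]]]]]]|[[Za [q [c [v [H ->]]]]] ->]].
  split; last by rewrite big1 // => i _; have /prime[_ ->] := H i; rewrite mulr0.
  by split => //; exists q, c, v; split => // i; have /prime[] := H i.
split => //; exists q, c, v, (fun=> 0); split; first by move=> i; exact/prime.
by split => //; rewrite big1 // => i _; rewrite mulr0.
Qed.

(** All values being 0, the forms alone parametrize the fibres, which gives [2 * rdim d p]
    iterations instead of [2 * (rdim d p).+1]. *)
Lemma tauP_stable k a xi : iter k (rhoP Z) (@E0 R d p Z) a xi -> tauP Z a xi.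
Proof.
move=> Ek; have /(tau_iter _ _ _ 0)[] // : iter (2 * rdim d p) (rhoR Z)
    (@Phi0 R d p Z (fun=> 0)) a xi 0.
pose N := rdim d p.
pose dec1 (v : 'rV[R]_N) : Pdual d p := [ffun g => v ord0 (enum_rank g)].
apply: (@iter_stabilization (fun=> 0) N dec1 (fun=> 0) N%:R) ((tau_iter k a xi 0).2 _) => //.
- by move=> c u v; apply/ffunP => g; rewrite !ffunE !mxE.
- by move=> c u v; rewrite mulr0 addr0.
- move=> v; apply: (@le_trans _ _ (\sum_(g : mi d p) `|v|)).
    by apply: ler_sum => g _; rewrite ffunE norm_coord_le.
  by rewrite sumr_const -[leLHS]mulr_natl ler_wpM2r.
- by move=> v; rewrite normr0 mulr_ge0.
- move=> j b zeta mu /tau_iter[_ ->]; exists (\row_i zeta (enum_val i)) => //.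
  by apply/ffunP => g; rewrite ffunE mxE enum_rankK.
Qed.

Lemma DeltaPhiZ Phi a b z nu (c : R) : linear_bundle Phi -> `|c| <= 1 ->
  DeltaPhi Z Phi a b z nu -> DeltaPhi Z Phi a b (c *: z) (c * nu).
Proof.
move=> lin c1 [Za [Zb [x1 [l1 [x2 [l2 [P1 [P2 [-> [-> B]]]]]]]]]].
split => //; split => //; exists (c *: x1), (c * l1), (c *: x2), (c * l2).
split; first exact: linear_bundleZ.
split; first exact: linear_bundleZ.
rewrite scalerDr mulrDr; do 2 split => //; move=> g.
rewrite zcompZ normrM mulrCA; apply: le_trans (B g).
by rewrite ler_piMl // mulr_ge0 // exprn_ge0 // sqrtr_ge0.
Qed.

(* If the values along the approximating sequence were unbounded, dividing by
   them would put (a, 0, 1) in Phi'. *)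
Lemma Eprime_lift (E : @bundle R d p) Phi a zeta : linear_bundle Phi ->
  (forall b xi, E b xi -> exists l, Phi b xi l) -> ~ Phiprime Z Phi a 0 1 ->
  Eprime Z E a zeta -> exists l, Phiprime Z Phi a zeta l.
Proof.
move=> lin EP n01 [Za HE].
pose W (e nu : R) := exists a1 b1 z, DeltaPhi Z Phi a1 b1 z nu /\
  eucl_norm (a1 - a) < e /\ eucl_norm (b1 - a) < e /\ dual_norm (z - zeta) < e.
have Wmono e e' nu : e' <= e -> W e' nu -> W e nu.
  move=> ee' [a1 [b1 [z [D [A [B C]]]]]]; exists a1, b1, z; split => //.
  by do 2 (split; first exact: lt_le_trans ee'); exact: lt_le_trans ee'.
have Wex e : 0 < e -> exists nu, W e nu.
  move=> /HE[a1 [b1 [z [[Z1 [Z2 [x1 [x2 [P1 [P2 [E1 B]]]]]]] H]]]].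
  have [l1 L1] := EP _ _ P1; have [l2 L2] := EP _ _ P2.
  exists (l1 + l2), a1, b1, z; split => //; split => //; split => //.
  by exists x1, l1, x2, l2.
have [[M HM]|nM] := pselect (exists M : R, forall e, 0 < e -> exists2 nu, W e nu & `|nu| <= M).
  have [e e' v|e e0|v Hv] := @cluster_rV R 1 (fun e v => W e (v ord0 ord0)) M.
  - exact: Wmono.
  - have [nu Wnu nM] := HM e e0; exists (const_mx nu); first by rewrite mxE.
    apply: norm_row_le => [|i]; last by rewrite mxE.
    exact: le_trans nM.
  - exists (v ord0 ord0); split => // e e0.
    have [w [a1 [b1 [z [D [A [B C]]]]]] wv] := Hv e e0.
    exists a1, b1, z, (w ord0 ord0); do 4 split => //.
    by apply: le_lt_trans wv; have := norm_coord_le (w - v) ord0; rewrite !mxE.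
case: n01; split => // e e0.
pose S := dual_norm zeta + 1; have S0 : 0 < S by rewrite ltr_wpDl ?dual_norm_ge0.
(* Above 1, division by [nu] preserves the constraint; above [S / e], it brings [z], of norm at most
   [S], within [e] of 0. *)
pose M := Num.max 1 (S / e).
have [e1 e10 He1] : exists2 e1 : R, 0 < e1 & forall nu, W e1 nu -> M < `|nu|.
  apply: contrapT => H; apply: nM; exists M => e1 e10.
  apply: contrapT => H'; apply: H; exists e1 => // nu Wnu.
  by rewrite ltNge; apply/negP => le; apply: H'; exists nu.
pose e2 := Num.min e1 (Num.min e 1).
have e20 : 0 < e2 by rewrite !lt_min e10 e0 ltr01.
have [nu Wnu] := Wex e2 e20.
have := He1 _ (Wmono e1 e2 nu _ Wnu); rewrite ge_min lexx => /(_ isT).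
rewrite gt_max => /andP[nu1 nuS].
have nun0 : nu != 0 by rewrite -normr_gt0 (lt_trans ltr01).
have [a1 [b1 [z [D [A [B C]]]]]] := Wnu.
move: A B C; rewrite !lt_min => /and3P[_ A _] /and3P[_ B _] /and3P[_ _ C].
exists a1, b1, (nu^-1 *: z), (nu^-1 * nu); split.
  by apply: DeltaPhiZ => //; rewrite normfV invf_le1 ?(lt_trans ltr01) // ltW.
do 2 split => //; rewrite mulVf // subrr normr0; split => //.
rewrite subr0 dual_normZ normfV mulrC ltr_pdivrMr ?(lt_trans ltr01) //.
apply: (@le_lt_trans _ _ S).
  rewrite -[z](subrK zeta) addrC; apply: le_trans (dual_normD _ _) _.
  by rewrite lerD2l ltW.
by rewrite mulrC -ltr_pdivrMr.
Qed.

(** Lifting from stage k uses [Eprime_lift] for the prime of stage k, which lies in stage k + 1;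
    hence the exclusion of (a, 0, 1) at all stages. *)
Lemma tau_lift h :
  (forall k a, Z a -> ~ iter k (rhoR Z) (@Phi0 R d p Z h) a 0 1) ->
  forall k a xi, iter k (rhoP Z) (@E0 R d p Z) a xi ->
    exists l, iter k (rhoR Z) (@Phi0 R d p Z h) a xi l.
Proof.
move=> n01; elim=> [|k IH] a xi.
  by move=> [Za [l ->]]; exists (l * h a); split => //; exists l.
move=> /= [Za [q [c [v [H ->]]]]].
have lin := linear_iter h k.
have /choice[w Hw] : forall i, exists l, Phiprime Z (iter k (rhoR Z) (@Phi0 R d p Z h)) a (v i) l.
  move=> i; apply: (Eprime_lift lin IH) (H i).
  by move=> /rhoR_prime1; exact: (n01 k.+1 a Za).
by exists (\sum_i c i * w i); split => //; exists q, c, v, w.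
Qed.

End Bundles.

(** * Functoriality of the iterates *)

Section Morphism.
Context {R : realType} {m n p : nat}.
Context (V Y : set 'rV[R]_m) (X : set 'rV[R]_n) (phi : 'rV[R]_m -> 'rV[R]_n).
Hypotheses (oV : open V) (Cphi : Cpmap p V phi).
Hypotheses (YV : Y `<=` V) (phiYX : forall y, Y y -> X (phi y)).

Lemma phi_continuous c (e : R) : V c -> 0 < e -> exists2 dl : R, 0 < dl &
  forall a, `|a - c| < dl -> eucl_norm (phi a - phi c) < e.
Proof.
move=> Vc e0; have n0 : 0 < n%:R + 1 :> R by rewrite ltr_wpDl.
have [|dl dl0 H] := @ball_forall R m 'I_n c
    (fun i y => `|phi y ord0 i - phi c ord0 i| < e / (n%:R + 1)).
  move=> i; apply: (proj1 (continuous_rowP (fun y => phi y ord0 i) c)).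
    exact: Cp_continuous (Cphi i) _ Vc.
  exact: divr_gt0.
exists dl => // a /H Ha; apply: le_lt_trans (eucl_le_norm _) _.
have : `|phi a - phi c| < e / (n%:R + 1).
  by apply: norm_row_lt => [|i]; [exact: divr_gt0|rewrite !mxE].
rewrite ltr_pdivlMr // mulrDr mulr1 => lt; apply: le_lt_trans lt.
by rewrite mulrC lerDl.
Qed.

(** [C] is the constant of [pushD_bound] at [c]; dividing by it restores the bound 1 in the
    constraint. It does not depend on the element of the fibre, and [pushD_iter] moves it into the
    coefficients of the span. *)
Lemma pushD_prime (Phi : @bundleR R m p) (Psi : @bundleR R n p) c :
  linear_bundle X Psi ->
  (forall b eta l, Phi b eta l -> Psi (phi b) (pushD phi b eta) l) -> Y c ->
  exists2 C : R, C != 0 & forall zeta lam, Phiprime Y Phi c zeta lam ->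
    Phiprime X Psi (phi c) (C^-1 *: pushD phi c zeta) (C^-1 * lam).
Proof.
move=> lin push Yc; have Vc := YV Yc.
have [C C1 [d1 d10 H1]] := pushD_bound oV Cphi Vc.
have C0 : 0 < C by apply: lt_le_trans C1.
have CV1 : C^-1 <= 1 by rewrite invf_le1.
exists C; first by rewrite gt_eqF.
move=> zeta lam [_ H]; split; first exact: phiYX.
move=> e e0; have e2 : 0 < e / 2 by rewrite divr_gt0.
have [d2 d20 H2] := pushD_continuous oV Cphi zeta Vc e2.
have [d3 d30 H3] := pushD_diff oV Cphi Vc e2.
have [d4 d40 H4] := phi_continuous Vc e0.
pose dl := Num.min (Num.min d1 d2) (Num.min (Num.min d3 d4) e).
have [|a [b [z [nu [[Ya [Yb [xi [l [eta [mu [P1 [P2 [zE [nuE B]]]]]]]]]] [ac [bc [zz nn]]]]]]]] := H dl.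
  by rewrite !lt_min d10 d20 d30 d40 e0.
have split_dl (t : R) : t < dl -> [/\ t < d1, t < d2, t < d3, t < d4 & t < e].
  by rewrite !lt_min => /andP[/andP[-> ->] /andP[/andP[-> ->] ->]].
have [a1 a2 a3 a4 _] := split_dl _ (le_lt_trans (norm_le_eucl _) ac).
have [b1 _ b3 b4 _] := split_dl _ (le_lt_trans (norm_le_eucl _) bc).
have [_ z2 _ _ _] := split_dl _ zz; have [_ _ _ _ ne] := split_dl _ nn.
exists (phi a), (phi b), (C^-1 *: (pushD phi a xi + pushD phi b eta)), (C^-1 * nu).
have CVn : `|C^-1| = C^-1 by rewrite ger0_norm // invr_ge0 ltW.
split.
  split; first exact: phiYX.
  split; first exact: phiYX.
  exists (C^-1 *: pushD phi a xi), (C^-1 * l), (C^-1 *: pushD phi b eta), (C^-1 * mu).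
  split; first by apply: (linear_bundleZ _ lin); exact: push.
  split; first by apply: (linear_bundleZ _ lin); exact: push.
  rewrite scalerDr nuE mulrDr; do 2 split => //; move=> g.
  rewrite zcompZ normrM CVn mulrCA mulrC ler_pdivrMr // mul1r.
  exact: H1 a1 b1 B g.
split; first exact: H4.
split; first exact: H4.
split; last first.
  rewrite -mulrBr normrM CVn; apply: le_lt_trans ne.
  by rewrite ler_piMl.
rewrite -scalerBr dual_normZ CVn; apply: (@le_lt_trans _ _
    (dual_norm (pushD phi a xi + pushD phi b eta - pushD phi c zeta))).
  by rewrite ler_piMl // dual_norm_ge0.
have -> : pushD phi a xi + pushD phi b eta - pushD phi c zeta =
    (pushD phi a z - pushD phi c zeta) + (pushD phi b eta - pushD phi a eta).
  rewrite zE pushDD; apply/ffunP => g; rewrite !ffunE; ring.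
apply: le_lt_trans (dual_normD _ _) _.
have := H2 _ _ a2 z2; have := H3 _ _ _ a3 b3 B; lra.
Qed.

Lemma pushD_iter (f : 'rV[R]_n -> R) k b eta l :
  iter k (rhoR Y) (@Phi0 R m p Y (fun y => f (phi y))) b eta l ->
  iter k (rhoR X) (@Phi0 R n p X f) (phi b) (pushD phi b eta) l.
Proof.
elim: k b eta l => [|k IH] b eta l.
  move=> [Yb [t [-> ->]]]; split; first exact: phiYX.
  by exists t; rewrite pushDZ pushD_delta.
move=> /= [Yb [q [c [v [w [H [-> ->]]]]]]].
have [C C0 HC] := pushD_prime (linear_iter X f k) IH Yb.
split; first exact: phiYX.
exists q, (fun i => c i * C), (fun i => C^-1 *: pushD phi b (v i)), (fun i => C^-1 * w i).
split; first by move=> i; exact: HC.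
split.
  by rewrite pushD_sum; apply: eq_bigr => i _; rewrite scalerA mulfK.
by apply: eq_bigr => i _; rewrite mulrA mulfK.
Qed.

Lemma pushD_tauP b eta : @tauP R m p Y b eta -> @tauP R n p X (phi b) (pushD phi b eta).
Proof.
move=> tb; apply: (@tauP_stable _ _ _ _ (2 * rdim m p)).
have /(pushD_iter (f := fun=> 0)) : iter (2 * rdim m p) (rhoR Y) (@Phi0 R m p Y (fun=> 0)) b eta 0.
  by apply/tau_iter.
by move=> /tau_iter[].
Qed.

Lemma tauP_base b eta : @tauP R m p Y b eta -> Y b.
Proof.
move=> tb; have [PZ _ _] := linear_iter Y (fun=> 0) (2 * rdim m p) (p := p).
by apply: (PZ b eta 0); apply/tau_iter.
Qed.

End Morphism.
Theorem theorem5p2 (R : realType) (n m p : nat)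
  (U X : set 'rV[R]_n) (V Y : set 'rV[R]_m) (phi : 'rV[R]_m -> 'rV[R]_n) :
  open U -> open V -> closed_in_set U X -> closed_in_set V Y ->
  (forall y, V y -> U (phi y)) -> Cpmap p V phi ->
  (forall y, Y y -> X (phi y)) ->
  (* (1) phi_* maps tauP^p(Y) into tauP^p(X) and is a bundle morphism *)
  ((forall b eta, @tauP R m p Y b eta -> @tauP R n p X (phi b) (pushD phi b eta)) /\
   (forall b (c : R) (eta1 eta2 : Pdual m p),
      pushD phi b (c *: eta1 + eta2) = c *: pushD phi b eta1 + pushD phi b eta2) /\
   (forall b eta, @tauP R m p Y b eta ->
      forall e : R, 0 < e -> exists2 dl : R, 0 < dl &
        forall b' eta', @tauP R m p Y b' eta' ->
          eucl_norm (b' - b) < dl -> dual_norm (eta' - eta) < dl ->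
          eucl_norm (phi b' - phi b) < e /\
          dual_norm (pushD phi b' eta' - pushD phi b eta) < e)) /\
  (forall f : 'rV[R]_n -> R, nablaP_is_fun p X f ->
   let g := fun y => f (phi y) in
   (* (2) *)
   nablaP_is_fun p Y g /\
   (forall b eta (lam : R), @tauP R m p Y b eta ->
      @nablaP R n p X f (phi b) (pushD phi b eta) lam -> @nablaP R m p Y g b eta lam) /\
   (* (3) *)
   (forall b (P : Ppoly n p), Y b ->
      (forall xi, @tauP R n p X (phi b) xi -> @nablaP R n p X f (phi b) xi (dapp xi P)) ->
      forall eta, @tauP R m p Y b eta -> @nablaP R m p Y g b eta (dapp eta (pullP phi b P)))).
Proof.
move=> oU oV cX [YV _] phiVU Cphi phiYX.
have push_tau := pushD_tauP oV Cphi YV phiYX.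
split.
  split; first exact: push_tau.
  split; first by move=> b c eta1 eta2; exact: pushD_lin.
  move=> b eta tb e e0; have Vb : V b by apply: YV; exact: tauP_base tb.
  have [d1 d10 H1] := pushD_continuous oV Cphi eta Vb e0.
  have [d2 d20 H2] := phi_continuous Cphi Vb e0.
  exists (Num.min d1 d2); first by rewrite lt_min d10.
  move=> b' eta' _; rewrite !lt_min => /andP[b1 b2] /andP[n1 _].
  split; first by apply: H2; exact: le_lt_trans (norm_le_eucl _) b2.
  by apply: H1 => //; exact: le_lt_trans (norm_le_eucl _) b1.
move=> f ff g.
have push_nabla k b eta lam : iter k (rhoR Y) (@Phi0 R m p Y g) b eta lam ->
    @nablaP R n p X f (phi b) (pushD phi b eta) lam.
  by move=> /(pushD_iter oV Cphi YV phiYX); exact: nablaP_stable.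
(* The triple (a, 0, 0) always belongs to the iterate, so uniqueness over X leaves no other value at
   the form 0. *)
have nabla0 a : X a -> forall lam : R, @nablaP R n p X f a 0 lam -> lam = 0.
  move=> Xa lam Hl.
  have t0 : @tauP R n p X a 0.
    have [_ P0 _] := linear_iter X (fun=> 0) (2 * rdim n p) (p := p).
    by have /tau_iter[] := P0 a Xa.
  have [l0 [_ uniq0]] := ff a 0 t0.
  have [_ N0 _] := linear_iter X f (2 * (rdim n p).+1) (p := p).
  by rewrite -(uniq0 _ Hl); exact: uniq0 (N0 a Xa).
have push0 b : pushD phi b (0 : Pdual m p) = 0.
  by have := pushDZ phi b 0 (0 : Pdual m p); rewrite !scale0r.
have n01 k a : Y a -> ~ iter k (rhoR Y) (@Phi0 R m p Y g) a 0 1.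
  move=> Ya /push_nabla; rewrite push0 => /(nabla0 _ (phiYX _ Ya)) /eqP.
  by rewrite oner_eq0.
have ex_nabla b eta : @tauP R m p Y b eta -> exists lam, @nablaP R m p Y g b eta lam.
  move=> /(tau_lift n01)[lam Hl]; exists lam; exact: nablaP_stable Hl.
have nabla_val b eta (lam : R) : @tauP R m p Y b eta ->
    @nablaP R n p X f (phi b) (pushD phi b eta) lam -> @nablaP R m p Y g b eta lam.
  (* Some value [l0] exists over Y; pushed forward, it is a value over X at the same form, hence
     equal to [lam]. *)
  move=> tb Hl; have [l0 Hl0] := ex_nabla _ _ tb.
  have [l1 [_ uniq1]] := ff _ _ (push_tau _ _ tb).
  by rewrite -(uniq1 _ Hl) (uniq1 _ (push_nabla _ _ _ _ Hl0)).
split; last split => //.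
- move=> b eta tb; have [lam Hl] := ex_nabla _ _ tb; exists lam; split => // l' Hl'.
  have [l1 [_ uniq1]] := ff _ _ (push_tau _ _ tb).
  by rewrite -(uniq1 _ (push_nabla _ _ _ _ Hl)) (uniq1 _ (push_nabla _ _ _ _ Hl')).
- move=> b P Yb HP eta tb; apply: nabla_val => //.
  rewrite -(dapp_pushD oV Cphi) //; last exact: YV.
  by apply: HP; exact: push_tau.
Qed.
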